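(* Let $\ell\ge2$ be fixed. For every $\ell$-party nondeterministic protocol $\Pi=(\mathcal R,t)$ on domain $D=\{0,1\}^{n_1}\times\cdots\times\{0,1\}^{n_\ell}$ and every $(x_1,\dots,x_\ell)\in D$, $$C(\tilde t\mid\Pi)\ \ge\ \frac{1}{\ell-1}\sum_{i=1}^{\ell}C(\tilde t\mid x_i,\Pi)-\frac{1}{\ell-1}\log\rho(\tilde t) - O(\log n),$$ where $\tilde t=t(x_1,\dots,x_\ell)$ and $n$ is the maximum length of the strings involved.
   Context: Fix a universal Turing machine $U$. $C(x\mid u)$ is the length of a shortest $p$ with $U(p,u)=x$; tuples and finite objects are encoded as strings by fixed computable encodings. A rectangle in $D$ is a set of the form $S_1\times\cdots\times S_\ell$ with $S_i\subseteq\{0,1\}^{n_i}$. An $\ell$-party (nondeterministic) protocol $\Pi=(\mathcal R,t)$ consists of a finite set $\mathcal R$ of rectangles whose union contains $D$, and a function $t$ assigning to each tuple $(x_1,\dots,x_\ell)\in D$ a rectangle of $\mathcal R$ containing it. $\Pi$ is regarded as a finite object, and a rectangle $t(x_1,\dots,x_\ell)$ is identified with a string encoding its index in $\mathcal R$. The thickness of a cell is the number of rectangles of $\mathcal R$ containing it; the thickness $\rho(R)$ of a rectangle $R$ is the maximum thickness of its cells. *)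

(* Defs.v *)
From HB Require Import structures.
From mathcomp Require Import all_boot all_order all_algebra.
From mathcomp Require Import boolp reals exp.

Set Implicit Arguments.
Unset Strict Implicit.
Unset Printing Implicit Defensive.

Import Order.TTheory GRing.Theory Num.Theory.

(* Deterministic multi-tape Turing machines over the tape alphabet {0, 1, blank};
   [None] is the blank.  *)

Inductive direction := MoveLeft | MoveRight | Stay.

(* A two-way infinite tape.  The head scans the first symbol of [right_part];
   [left_part] lists the cells to its left, nearest first.  All cells not
   listed are blank. *)
Record tape := Tape { left_part : seq (option bool); right_part : seq (option bool) }.

Definition tape_of (s : bitseq) : tape := Tape [::] (map Some s).

Definition tape_read (t : tape) : option bool := head None (right_part t).

Definition tape_write (a : option bool) (t : tape) : tape :=
  Tape (left_part t) (a :: behead (right_part t)).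

Definition tape_move (d : direction) (t : tape) : tape :=
  match d with
  | MoveLeft => Tape (behead (left_part t)) (head None (left_part t) :: right_part t)
  | MoveRight => Tape (tape_read t :: left_part t) (behead (right_part t))
  | Stay => t
  end.

Fixpoint bits_prefix (s : seq (option bool)) : bitseq :=
  if s is Some b :: s' then b :: bits_prefix s' else [::].

(* The bits from the head up to the next blank. *)
Definition tape_output (t : tape) : bitseq := bits_prefix (right_part t).

(* Tape 0 holds the program, tape 1 the condition and tape 2 the output; there
   are [extra_tapes] further work tapes.  The machine halts when [trans]
   returns [None]. *)
Record TM := {
  TM_state : finType;
  extra_tapes : nat;
  TM_start : TM_state;
  TM_trans : TM_state -> {ffun 'I_extra_tapes.+3 -> option bool} ->
    option (TM_state * ('I_extra_tapes.+3 -> option bool * direction))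
}.

Section Runs.
Variable M : TM.

Record config := Config {
  cfg_state : TM_state M;
  cfg_tapes : 'I_(extra_tapes M).+3 -> tape
}.

Definition scanned (c : config) : {ffun 'I_(extra_tapes M).+3 -> option bool} :=
  [ffun i => tape_read (cfg_tapes c i)].

Definition TM_next (c : config) := TM_trans (cfg_state c) (scanned c).

Definition TM_step (c : config) : config :=
  if TM_next c is Some (q, act) then
    Config q (fun i => tape_move (act i).2 (tape_write (act i).1 (cfg_tapes c i)))
  else c.

Definition TM_halted (c : config) : bool := ~~ isSome (TM_next c).

Definition TM_init (p u : bitseq) : config :=
  Config (TM_start M) (fun i => tape_of (nth [::] [:: p; u] i)).

(* M(p, u) is defined and equal to x. *)
Definition computes (p u x : bitseq) : Prop :=
  exists n : nat, let c := iter n TM_step (TM_init p u) in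
    TM_halted c /\ tape_output (cfg_tapes c (inord 2)) = x.

End Runs.

(* U simulates every machine with an additive constant overhead in program
   length.  This covers the usual form U(w_M ++ p, u) = M(p, u). *)
Definition universal (U : TM) : Prop :=
  forall M : TM, exists c : nat, forall p : bitseq,
    exists2 q : bitseq, size q <= size p + c &
      forall u x : bitseq, computes U q u x <-> computes M p u x.

(* C(x | u) with respect to U.  The default value 0 is never used when U is
   universal, as every x then has a program. *)
Definition KC (U : TM) (x u : bitseq) : nat :=
  match pselect (exists n, `[< exists2 p, size p = n & computes U p u x >]) with
  | left ex => ex_minn ex
  | right _ => 0
  end.

(* Self-delimiting form of a string: each bit is preceded by 1, and 0 ends it. *)
Fixpoint delimited (s : bitseq) : bitseq :=
  if s is b :: s' then true :: b :: delimited s' else [:: false].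

(* Encoding of finite sequences of strings, used for tuples at every level. *)
Definition encode (ss : seq bitseq) : bitseq := flatten (map delimited ss).

Fixpoint bin_succ (s : bitseq) : bitseq :=
  match s with
  | [::] => [:: true]
  | false :: s' => true :: s'
  | true :: s' => false :: bin_succ s'
  end.

(* Binary numeral, least significant bit first, without superfluous zeros. *)
Definition binary (n : nat) : bitseq := iter n bin_succ [::].

Section Protocols.
Variables (l : nat) (ns : 'I_l -> nat).

Definition cell : finType := {dffun forall i : 'I_l, (ns i).-tuple bool}.

Definition is_rectangle (Q : {set cell}) : Prop :=
  exists S : forall i : 'I_l, {set (ns i).-tuple bool}, Q = setXn S.

(* The set of rectangles is given by a duplicate-free enumeration, which fixes
   the index of each rectangle. *)
Record protocol := {
  rects : seq {set cell};
  transcript : cell -> {set cell};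
  rects_uniq : uniq rects;
  rects_rectangle : forall Q, Q \in rects -> is_rectangle Q;
  rects_cover : forall x : cell, exists2 Q, Q \in rects & x \in Q;
  transcript_rects : forall x : cell, transcript x \in rects;
  transcript_mem : forall x : cell, x \in transcript x
}.

Variable P : protocol.

Definition cell_thickness (x : cell) : nat := #|[set Q in rects P | x \in Q]|.

Definition thickness (Q : {set cell}) : nat := \max_(x in Q) cell_thickness x.

Definition rect_string (Q : {set cell}) : bitseq := binary (index Q (rects P)).

Definition cell_string (x : cell) : bitseq :=
  encode [seq (x i : bitseq) | i <- enum 'I_l].

(* (n_1, ..., n_l), the rectangles as lists of cells, and the graph of t. *)
Definition protocol_string : bitseq :=
  encode [:: encode [seq binary (ns i) | i <- enum 'I_l];
             encode [seq encode [seq cell_string x | x <- enum Q] | Q : {set cell} <- rects P];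
             encode [seq encode [:: cell_string x; rect_string (transcript P x)]
                    | x <- enum cell]].

(* The maximum of the lengths of x_1, ..., x_l and of t(x_1, ..., x_l). *)
Definition max_length (x : cell) : nat :=
  maxn (\max_(i < l) size (x i)) (size (rect_string (transcript P x))).

End Protocols.

Definition log2 (R : realType) (x : R) : R := (ln x / ln 2)%R.

(* Main.v *)
Require Import Defs.
From HB Require Import structures.
From mathcomp Require Import all_boot all_order all_algebra.
From mathcomp Require Import boolp reals exp.
From mathcomp Require Import zify lra.

Set Implicit Arguments.
Unset Strict Implicit.
Unset Printing Implicit Defensive.

(* Write u for the protocol, t for the transcript, m = C(t|u), k_i = C(t|x_i,u)
   and b_i = C(x_i|u), and let X_i be the set of those x' in the i-th side of t
   that have C(x'|u) <= b_i, with 2^A_i <= |X_i| < 2^(A_i+1).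

   Symmetry of information: consider the pairs (r, x') where C(r|u) <= m and x'
   is one of the first 2^(A_i+1) enumerated elements of the i-th side of r of
   complexity at most b_i.  There are at most 2^(m+A_i+2) of them, and (t, x_i)
   is one.  If x_i has about 2^K partners r, then k_i <= K up to logarithmic
   terms, since t is one of these partners, and b_i <= m + A_i - K, since only
   2^(m+A_i+2-K) strings have that many partners.  Thus k_i + b_i <= m + A_i.

   Thickness: let G be the set of rectangles r of thickness at most rho(t) for
   which the set analogous to X_i has at least 2^A_i elements for every i.  Each
   r in G contains at least 2^(A_1+...+A_l) cells all of whose coordinates x'_i
   have complexity at most b_i; there are at most 2^(b_1+...+b_l+l) such cells
   and each lies in at most rho(t) members of G.  As t is in G, this gives
   m + sum A_i <= sum b_i + log rho(t).  Adding the inequalities eliminates the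
   b_i and the A_i.

   All the sets involved are enumerable relative to u.  Enumerability by Turing
   machines is obtained by compiling a first-order language of functions on
   binary trees, first to programs on bit stacks, then to machines. *)

(** * Stack programs on Turing machines *)

Notation symbols := {ffun 'I_7 -> option bool}.
Notation tapes := ('I_7 -> tape).

(** Machines with exactly four work tapes, hence seven tapes. A constant tape count lets machines be
    combined without casts between index types. *)
Record machine := Machine {
  m_state : finType;
  m_start : m_state;
  m_trans : m_state -> symbols ->
    option (m_state * ('I_7 -> option bool * direction))
}.

Definition TM_of_machine (m : machine) : TM :=
  @Build_TM (m_state m) 4 (m_start m) (@m_trans m).

Definition scan (ts : tapes) : symbols := [ffun i => tape_read (ts i)].

Definition act_on (act : 'I_7 -> option bool * direction) (ts : tapes) : tapes :=
  fun i => tape_move (act i).2 (tape_write (act i).1 (ts i)).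

Inductive reach (m : machine) : m_state m -> tapes -> m_state m -> tapes -> Prop :=
| reach_refl q ts : reach q ts q ts
| reach_step q ts q1 act q' ts' :
    m_trans q (scan ts) = Some (q1, act) ->
    reach q1 (act_on act ts) q' ts' -> reach q ts q' ts'.

Lemma reach_trans m (q1 q2 q3 : m_state m) t1 t2 t3 :
  reach q1 t1 q2 t2 -> reach q2 t2 q3 t3 -> reach q1 t1 q3 t3.
Proof.
elim=> // q ts q' act q'' ts' e _ IH r; apply: reach_step e _; exact: IH.
Qed.

(* The head of each tape is at the top of a stack; whatever lies to its left is
   overwritten before it is read. *)
Definition holds (ts : tapes) (s : seq bitseq) : Prop :=
  forall i : 'I_7, exists k,
    right_part (ts i) = map Some (nth [::] s i) ++ nseq k None.

Definition m_runs (m : machine) (s s' : seq bitseq) : Prop :=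
  forall ts, holds ts s -> exists q' ts',
    [/\ reach (m_start m) ts q' ts', m_trans q' (scan ts') = None & holds ts' s'].

Definition keep (sc : symbols) : 'I_7 -> option bool * direction :=
  fun j => (sc j, Stay).

Lemma scan_holds ts s i : holds ts s -> scan ts i = ohead (nth [::] s i).
Proof.
move=> /(_ i)[k e]; rewrite ffunE /tape_read e.
by case: (nth _ _ _) => [|a r] //=; case: k {e}.
Qed.

(** Rewriting the blank scanned on an unlisted cell makes that cell explicit, so the number of
    listed trailing blanks may grow. This is why [holds] leaves that number open. *)
Lemma holds_keep_tape t b k :
  right_part t = map Some b ++ nseq k None -> exists k',
  right_part (tape_move Stay (tape_write (tape_read t) t)) = map Some b ++ nseq k' None.
Proof.
rewrite /tape_read /= => ->; case: b => [|a b] /=; last by exists k.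
by case: k => [|k]; [exists 1 | exists k.+1].
Qed.

Lemma holds_keep ts s : holds ts s -> holds (act_on (keep (scan ts)) ts) s.
Proof.
move=> h i; have [k e] := h i; rewrite /act_on /= ffunE; exact: holds_keep_tape e.
Qed.

Definition focus (i : 'I_7) (a : option bool * direction) (sc : symbols) :
    'I_7 -> option bool * direction :=
  fun j => if j == i then a else keep sc j.

Lemma holds_focus ts s s' i a :
  holds ts s -> (forall j : 'I_7, j != i -> nth [::] s' j = nth [::] s j) ->
  (exists k, right_part (tape_move a.2 (tape_write a.1 (ts i))) =
      map Some (nth [::] s' i) ++ nseq k None) ->
  holds (act_on (focus i a (scan ts)) ts) s'.
Proof.
move=> h hs hi j; rewrite /act_on /focus; case: eqVneq => [->|ne]; first exact: hi.
rewrite hs //; exact: holds_keep h j.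
Qed.

(** Two moves: step left onto a cell of unknown content, then overwrite it with the new top. *)
Definition push_machine (i : 'I_7) (b : bool) : machine :=
  @Machine 'I_3 ord0 (fun q sc =>
    if q == 0 :> nat then Some (inord 1, focus i (sc i, MoveLeft) sc)
    else if q == 1 :> nat then Some (inord 2, focus i (Some b, Stay) sc)
    else None).

Definition upd (s : seq bitseq) (i : nat) (x : bitseq) := set_nth [::] s i x.

Lemma nth_upd s i x j : nth [::] (upd s i x) j = if j == i then x else nth [::] s j.
Proof. by rewrite nth_set_nth. Qed.

Lemma push_runs (i : 'I_7) b s : m_runs (push_machine i b) s (upd s i (b :: nth [::] s i)).
Proof.
move=> ts h; set ts1 := act_on (focus i (scan ts i, MoveLeft) (scan ts)) ts.
exists (inord 2), (act_on (focus i (Some b, Stay) (scan ts1)) ts1); split.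
- apply: reach_step; first by rewrite /=.
  apply: (@reach_step (push_machine i b) (inord 1)); first by rewrite /= inordK.
  exact: reach_refl.
- by rewrite /= inordK.
move=> j; rewrite nth_upd; case: (eqVneq j i) => [->|ne].
  have [k e] := h i; rewrite eqxx {1}/act_on /focus eqxx /=.
  rewrite {1}/ts1 /act_on /focus eqxx /= ffunE.
  have [k' e'] := holds_keep_tape e.
  by exists k'; rewrite -e' /=.
have -> : (val j == val i) = false by apply/negbTE.
have h1 : exists k, right_part (ts1 j) = map Some (nth [::] s j) ++ nseq k None.
  by rewrite /ts1 /act_on /focus (negbTE ne); apply: holds_keep.
have [k e] := h1; rewrite /act_on /focus (negbTE ne) /keep /= ffunE.
exact: holds_keep_tape e.
Qed.

Definition pop_machine (i : 'I_7) : machine :=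
  @Machine bool true (fun q sc =>
    if q then Some (false, focus i (sc i, MoveRight) sc) else None).

Lemma pop_runs (i : 'I_7) s : m_runs (pop_machine i) s (upd s i (behead (nth [::] s i))).
Proof.
move=> ts h; set ts1 := act_on (focus i (scan ts i, MoveRight) (scan ts)) ts.
exists false, ts1; split=> //.
  by apply: reach_step; [rewrite /= | exact: reach_refl].
apply: (holds_focus h) => [j ne|]; rewrite nth_upd.
  by have -> : (val j == val i) = false by apply/negbTE.
rewrite eqxx /=; have [k e] := h i; rewrite e.
case: (nth _ _ _) => [|a r] /=; last by exists k.
by exists k.-1; case: k {e}.
Qed.

Definition skip_machine : machine := @Machine unit tt (fun _ _ => None).

Lemma skip_runs s : m_runs skip_machine s s.
Proof. by move=> ts h; exists tt, ts; split=> //; exact: reach_refl. Qed.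

(** A missing transition of the first machine triggers the hand-over, an idle step that preserves
    [holds] by [holds_keep]. *)
Definition seq_machine (m1 m2 : machine) : machine :=
  @Machine (m_state m1 + m_state m2)%type (inl (m_start m1)) (fun q sc =>
    match q with
    | inl q1 => if m_trans q1 sc is Some (q1', a) then Some (inl q1', a)
                else Some (inr (m_start m2), keep sc)
    | inr q2 => if m_trans q2 sc is Some (q2', a) then Some (inr q2', a) else None
    end).

(** Transitions are preserved only where they are defined, so a composite machine is free to
    continue where its component halts. *)
Lemma reach_embed (m m' : machine) (f : m_state m -> m_state m') :
  (forall q sc q' a, m_trans q sc = Some (q', a) ->
     m_trans (f q) sc = Some (f q', a)) ->
  forall q ts q' ts', reach q ts q' ts' -> reach (f q) ts (f q') ts'.
Proof.
move=> hf q ts q' ts'; elim=> [q0 ts0|q0 ts0 q1 act q2 ts2 e _ IH].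
  exact: reach_refl.
exact: reach_step (hf _ _ _ _ e) IH.
Qed.

Lemma seq_runs m1 m2 s1 s2 s3 :
  m_runs m1 s1 s2 -> m_runs m2 s2 s3 -> m_runs (seq_machine m1 m2) s1 s3.
Proof.
move=> h1 h2 ts h; have [q1 [ts1 [r1 e1 ho1]]] := h1 _ h.
have [q2 [ts2 [r2 e2 ho2]]] := h2 _ (holds_keep ho1).
exists (inr q2), ts2; split=> //; last by rewrite /= e2.
apply: (@reach_trans (seq_machine m1 m2) _ (inl q1) _ _ ts1).
  by apply: (reach_embed (m' := seq_machine m1 m2) _ r1) => q sc q' a /= ->.
apply: (@reach_step (seq_machine m1 m2) _ _ (inr (m_start m2))); first by rewrite /= e1.
by apply: (reach_embed (m' := seq_machine m1 m2) _ r2) => q sc q' a /= ->.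
Qed.

Definition if_machine (i : 'I_7) (T : pred (option bool)) (m1 m2 : machine) :=
  @Machine (option (m_state m1 + m_state m2)) None (fun q sc =>
    match q with
    | None => Some (Some (if T (sc i) then inl (m_start m1) else inr (m_start m2)),
                    keep sc)
    | Some (inl q1) =>
        if m_trans q1 sc is Some (q1', a) then Some (Some (inl q1'), a) else None
    | Some (inr q2) =>
        if m_trans q2 sc is Some (q2', a) then Some (Some (inr q2'), a) else None
    end).

Lemma if_runs (i : 'I_7) T m1 m2 s s' :
  (if T (ohead (nth [::] s i)) then m_runs m1 s s' else m_runs m2 s s') ->
  m_runs (if_machine i T m1 m2) s s'.
Proof.
move=> hr ts h; have sc := scan_holds i h.
have [[Tt hr1]|[Tf hr2]] : T (scan ts i) = true /\ m_runs m1 s s' \/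
    T (scan ts i) = false /\ m_runs m2 s s'.
  by rewrite sc; move: hr; case: (T _); [left|right].
  have [q1 [ts1 [r1 e1 ho1]]] := hr1 _ (holds_keep h).
  exists (Some (inl q1)), ts1; split=> //; last by rewrite /= e1.
  apply: (@reach_step (if_machine i T m1 m2) _ _ (Some (inl (m_start m1)))); first by rewrite /= Tt.
  apply: (reach_embed (m' := if_machine i T m1 m2) (f := Some \o inl) _ r1).
  by move=> q ? q' a /= ->.
have [q1 [ts1 [r1 e1 ho1]]] := hr2 _ (holds_keep h).
exists (Some (inr q1)), ts1; split=> //; last by rewrite /= e1.
apply: (@reach_step (if_machine i T m1 m2) _ _ (Some (inr (m_start m2)))); first by rewrite /= Tf.
apply: (reach_embed (m' := if_machine i T m1 m2) (f := Some \o inr) _ r1).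
by move=> q ? q' a /= ->.
Qed.

Definition while_machine (i : 'I_7) (T : pred (option bool)) (m : machine) :=
  @Machine (option (m_state m)) None (fun q sc =>
    match q with
    | None => if T (sc i) then Some (Some (m_start m), keep sc) else None
    | Some q => if m_trans q sc is Some (q', a) then Some (Some q', a)
                else Some (None, keep sc)
    end).

Lemma while_runs_false (i : 'I_7) T m s :
  ~~ T (ohead (nth [::] s i)) -> m_runs (while_machine i T m) s s.
Proof.
move=> nT ts h; exists None, ts; split=> //; first exact: reach_refl.
by rewrite /= (scan_holds i h) (negbTE nT).
Qed.

Lemma while_runs_true (i : 'I_7) (T : pred (option bool)) m s1 s2 s3 :
  T (ohead (nth [::] s1 i)) -> m_runs m s1 s2 ->
  m_runs (while_machine i T m) s2 s3 -> m_runs (while_machine i T m) s1 s3.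
Proof.
move=> Tt h1 h2 ts h; have [q1 [ts1 [r1 e1 ho1]]] := h1 _ (holds_keep h).
have [q2 [ts2 [r2 e2 ho2]]] := h2 _ (holds_keep ho1).
exists q2, ts2; split=> //.
apply: (@reach_step (while_machine i T m) _ _ (Some (m_start m))).
  by rewrite /= (scan_holds i h) Tt.
apply: (@reach_trans (while_machine i T m) _ (Some q1) _ _ ts1).
  by apply: (reach_embed (m' := while_machine i T m) _ r1) => q sc q' a /= ->.
by apply: reach_step r2; rewrite /= e1.
Qed.

Inductive cmd :=
| Skip
| Push of 'I_7 & bool
| Pop of 'I_7
| Seq of cmd & cmd
| If of 'I_7 & pred (option bool) & cmd & cmd
| While of 'I_7 & pred (option bool) & cmd.

Fixpoint compile (c : cmd) : machine :=
  match c with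
  | Skip => skip_machine
  | Push i b => push_machine i b
  | Pop i => pop_machine i
  | Seq c1 c2 => seq_machine (compile c1) (compile c2)
  | If i T c1 c2 => if_machine i T (compile c1) (compile c2)
  | While i T c => while_machine i T (compile c)
  end.

Inductive exec : cmd -> seq bitseq -> seq bitseq -> Prop :=
| exec_skip s : exec Skip s s
| exec_push (i : 'I_7) b s : exec (Push i b) s (upd s i (b :: nth [::] s i))
| exec_pop (i : 'I_7) s : exec (Pop i) s (upd s i (behead (nth [::] s i)))
| exec_seq c1 c2 s1 s2 s3 : exec c1 s1 s2 -> exec c2 s2 s3 -> exec (Seq c1 c2) s1 s3
| exec_if_true (i : 'I_7) (T : pred (option bool)) c1 c2 s s' :
    T (ohead (nth [::] s i)) -> exec c1 s s' -> exec (If i T c1 c2) s s'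
| exec_if_false (i : 'I_7) (T : pred (option bool)) c1 c2 s s' :
    ~~ T (ohead (nth [::] s i)) -> exec c2 s s' -> exec (If i T c1 c2) s s'
| exec_while_false (i : 'I_7) (T : pred (option bool)) c s :
    ~~ T (ohead (nth [::] s i)) -> exec (While i T c) s s
| exec_while_true (i : 'I_7) (T : pred (option bool)) c s1 s2 s3 :
    T (ohead (nth [::] s1 i)) -> exec c s1 s2 -> exec (While i T c) s2 s3 ->
    exec (While i T c) s1 s3.

Lemma exec_compile c s s' : exec c s s' -> m_runs (compile c) s s'.
Proof.
elim=> {c s s'}.
- exact: skip_runs.
- exact: push_runs.
- exact: pop_runs.
- by move=> c1 c2 s1 s2 s3 _ h1 _ h2; apply: seq_runs h1 h2.
- by move=> i T c1 c2 s s' Tt _ h; apply: if_runs; rewrite Tt.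
- by move=> i T c1 c2 s s' Tf _ h; apply: if_runs; rewrite (negbTE Tf).
- by move=> i T c s Tf; apply: while_runs_false.
- by move=> i T c s1 s2 s3 Tt _ h1 _ h2; apply: while_runs_true h1 h2.
Qed.

Lemma exec_computes c p u s' :
  exec c [:: p; u; [::]; [::]; [::]; [::]; [::]] s' ->
  computes (TM_of_machine (compile c)) p u (nth [::] s' 2).
Proof.
move=> /exec_compile; set m := compile c => hr.
(* Tapes 0 and 1 carry the two inputs; the default of [nth] leaves all the others empty. *)
have h0 : holds (@cfg_tapes (TM_of_machine m) (TM_init _ p u))
    [:: p; u; [::]; [::]; [::]; [::]; [::]].
  move=> i; exists 0; rewrite cats0 /=.
  by case: i => -[|[|[|[|[|[|[|]]]]]]].
have [q' [ts' [r e h']]] := hr _ h0.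
suff [n en] : exists n, iter n (@TM_step (TM_of_machine m)) (TM_init _ p u) =
    @Config (TM_of_machine m) q' ts'.
  exists n; rewrite /= en; split; first by rewrite /TM_halted /TM_next /= /scanned e.
  (* The output ends at the first blank, so trailing blanks do not affect it. *)
  rewrite /tape_output /=; have [k ->] := h' (inord 2); rewrite inordK //.
  by elim: (nth _ _ _) => [|b x IH] /=; [case: k | rewrite IH].
rewrite /TM_init; move: r; rewrite /=.
elim=> [q ts|q ts q1 act q2 ts2 et _ [n en]]; first by exists 0.
exists n.+1; rewrite iterSr {2}/TM_step /TM_next /= /scanned.
by rewrite (_ : m_trans _ _ = Some (q1, act)).
Qed.

(** * Functions on binary trees *)

Inductive tree := Leaf | Node of tree & tree.

(** Prefix notation is self-delimiting: a tree on top of a stack can be read off whatever lies below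
    it. *)
Fixpoint tree_bits (v : tree) : bitseq :=
  if v is Node a b then true :: tree_bits a ++ tree_bits b else [:: false].

Definition tree_fst v := if v is Node a _ then a else Leaf.
Definition tree_snd v := if v is Node _ b then b else Leaf.

Inductive fn :=
| FId
| FComp of fn & fn
| FPair of fn & fn
| FFst
| FSnd
| FLeaf
| FIf of fn & fn & fn
| FWhile of fn & fn.

Inductive ev : fn -> tree -> tree -> Prop :=
| ev_id v : ev FId v v
| ev_comp f g v w x : ev g v w -> ev f w x -> ev (FComp f g) v x
| ev_pair f g v a b : ev f v a -> ev g v b -> ev (FPair f g) v (Node a b)
| ev_fst v : ev FFst v (tree_fst v)
| ev_snd v : ev FSnd v (tree_snd v)
| ev_leaf v : ev FLeaf v Leaf
| ev_if_node f g h v a b w : ev f v (Node a b) -> ev g v w -> ev (FIf f g h) v w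
| ev_if_leaf f g h v w : ev f v Leaf -> ev h v w -> ev (FIf f g h) v w
| ev_while_leaf f g v : ev f v Leaf -> ev (FWhile f g) v v
| ev_while_node f g v a b w x : ev f v (Node a b) -> ev g v w ->
    ev (FWhile f g) w x -> ev (FWhile f g) v x.

(** Registers 0 to 2 are the program, condition and output tapes. Trees are stacked on [rD]; [rA],
    [rB] and [rC] are scratch space, empty between operations on trees. *)
Notation reg k := (@Ordinal 7 k isT).
Notation rP := (reg 0).
Notation rU := (reg 1).
Notation rO := (reg 2).
Notation rD := (reg 3).
Notation rA := (reg 4).
Notation rB := (reg 5).
Notation rC := (reg 6).

Notation top1 := (pred1 (Some true)).
Notation nonempty := (fun o : option bool => isSome o).

Infix ";;" := Seq (at level 60, right associativity).

Definition pour (i j : 'I_7) : cmd :=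
  While i nonempty (If i top1 (Push j true) (Push j false) ;; Pop i).

Definition clear (i : 'I_7) : cmd := While i nonempty (Pop i).

Lemma exec_pour (i j : 'I_7) s : i != j -> size s = 7 ->
  exec (pour i j) s (upd (upd s j (rev (nth [::] s i) ++ nth [::] s j)) i [::]).
Proof.
move=> ne; move ex : (nth [::] s i) => x.
have neq : (val i == val j) = false by apply/negbTE.
elim: x s ex => [|b x IH] s ex hs.
  have -> : upd (upd s j (rev [::] ++ nth [::] s j)) i [::] = s.
    apply: (@eq_from_nth _ [::]); rewrite /upd !size_set_nth hs.
      by have := ltn_ord i; have := ltn_ord j; lia.
    move=> k _; rewrite !nth_upd; case: eqP => [->|_]; first by rewrite ex.
    by case: eqP => [->|].
  by apply: exec_while_false; rewrite ex.
set s1 := upd (upd s j (b :: nth [::] s j)) i x.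
apply: (@exec_while_true _ _ _ _ s1); first by rewrite ex.
  apply: (@exec_seq _ _ _ (upd s j (b :: nth [::] s j))).
    by case: b ex @s1 => ex s1; [apply: exec_if_true|apply: exec_if_false];
      rewrite ?ex //; apply: exec_push.
  by have := exec_pop i (upd s j (b :: nth [::] s j)); rewrite nth_upd neq ex.
have hs1 : size s1 = 7.
  by rewrite /s1 /upd !size_set_nth hs; have := ltn_ord i; have := ltn_ord j; lia.
have /IH := hs1; rewrite /s1 !nth_upd eqxx => /(_ erefl).
rewrite [val j == val i]eq_sym neq eqxx.
congr exec; apply: (@eq_from_nth _ [::]).
  by rewrite /upd !size_set_nth hs; have := ltn_ord i; have := ltn_ord j; lia.
move=> k _; rewrite !nth_upd; case: eqP => // _; case: eqP => // _.
by rewrite rev_cons cat_rcons.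
Qed.

(* [rC] holds one bit for each subtree still to be read. *)
Definition move_tree (j : 'I_7) : cmd :=
  Push rC true ;;
  While rC top1 (Pop rC ;;
    If rD top1 (Pop rD ;; Push j true ;; Push rC true ;; Push rC true)
               (Pop rD ;; Push j false)).

Lemma exec_push_AB (k x : bool) p u o d a b c :
  exec (Push (if k then rB else rA) x) [:: p; u; o; d; a; b; c]
    [:: p; u; o; d; if k then a else x :: a; if k then x :: b else b; c].
Proof. by case: k; apply: exec_push. Qed.

Lemma exec_move_tree (k : bool) v p u o d a b :
  exec (move_tree (if k then rB else rA)) [:: p; u; o; tree_bits v ++ d; a; b; [::]]
    [:: p; u; o; d; if k then a else rev (tree_bits v) ++ a;
        if k then rev (tree_bits v) ++ b else b; [::]].
Proof.
apply: exec_seq; first exact: exec_push; rewrite /upd /=.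
set body := (Pop rC ;; _).
(* The invariant is in continuation form: a run from the state after [v] has been moved extends to a
   run from the state before. The two subtrees of a node can then be handled one after the other. *)
have loop c s' : exec (While rC top1 body)
      [:: p; u; o; d; if k then a else rev (tree_bits v) ++ a;
          if k then rev (tree_bits v) ++ b else b; c] s' ->
    exec (While rC top1 body) [:: p; u; o; tree_bits v ++ d; a; b; true :: c] s'.
  elim: v d a b c s' => [|v IHv w IHw] d a b c s' h.
    apply: exec_while_true h => //.
    apply: exec_seq; first exact: exec_pop.
    apply: exec_if_false => //.
    by apply: exec_seq; [exact: exec_pop | exact: exec_push_AB].
  apply: exec_while_true; first by [].
    apply: exec_seq; first exact: exec_pop.
    apply: exec_if_true => //.
    apply: exec_seq; first exact: exec_pop.
    apply: exec_seq; first exact: exec_push_AB.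
    apply: exec_seq; first exact: exec_push.
    exact: exec_push.
  rewrite /upd /= -catA; apply: IHv; apply: IHw.
  by case: (k) h; rewrite /= rev_cons rev_cat cat_rcons catA.
by apply: loop; apply: exec_while_false.
Qed.

Definition data (o d : bitseq) : seq bitseq := [:: [::]; [::]; o; d; [::]; [::]; [::]].

Definition drop_tree : cmd := move_tree rA ;; clear rA.

Lemma exec_drop v o d : exec drop_tree (data o (tree_bits v ++ d)) (data o d).
Proof.
apply: exec_seq; first exact: (exec_move_tree false); rewrite cats0 /data.
elim: (rev _) => [|b s IH]; first exact: exec_while_false.
by apply: exec_while_true IH => //; exact: exec_pop.
Qed.

(** [move_tree] reverses a tree and [pour] reverses it back; pouring [rA] first leaves the other
    tree on top. *)
Definition swap_tree : cmd := move_tree rA ;; move_tree rB ;; pour rA rD ;; pour rB rD.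

Lemma exec_swap v w o d :
  exec swap_tree (data o (tree_bits v ++ tree_bits w ++ d))
    (data o (tree_bits w ++ tree_bits v ++ d)).
Proof.
apply: exec_seq; first exact: (exec_move_tree false); rewrite cats0.
apply: exec_seq; first exact: (exec_move_tree true); rewrite cats0.
apply: exec_seq; first exact: exec_pour; rewrite /upd /= revK.
by have := @exec_pour rB rD [:: [::]; [::]; o; tree_bits v ++ d; [::]; rev (tree_bits w); [::]];
   rewrite /upd /= revK; apply.
Qed.

(* Emptying one stack into another reverses it, hence the detour of the second
   copy through [rB] and [rA]. *)
Definition dup_tree : cmd :=
  move_tree rA ;;
  While rA nonempty (If rA top1 (Push rD true ;; Push rB true)
                                (Push rD false ;; Push rB false) ;; Pop rA) ;;
  pour rB rA ;; pour rA rD.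

Lemma exec_dup v o d :
  exec dup_tree (data o (tree_bits v ++ d)) (data o (tree_bits v ++ tree_bits v ++ d)).
Proof.
apply: exec_seq; first exact: (exec_move_tree false); rewrite cats0.
apply: (@exec_seq _ _ _ [:: [::]; [::]; o; tree_bits v ++ d; [::]; tree_bits v; [::]]).
  have loop x b d0 : exec (While rA nonempty (If rA top1 (Push rD true ;; Push rB true)
        (Push rD false ;; Push rB false) ;; Pop rA))
      [:: [::]; [::]; o; d0; x; b; [::]] [:: [::]; [::]; o; rev x ++ d0; [::]; rev x ++ b; [::]];
    last by have := loop (rev (tree_bits v)) [::] d; rewrite revK cats0.
  elim: x b d0 => [|a x IH] b d0; first exact: exec_while_false.
  apply: exec_while_true; first by [].
    apply: (@exec_seq _ _ _ [:: [::]; [::]; o; a :: d0; a :: x; a :: b; [::]]); last exact: exec_pop.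
    case: a; [apply: exec_if_true | apply: exec_if_false] => //.
      by apply: exec_seq; [exact: exec_push|rewrite /upd /=; exact: exec_push].
    by apply: exec_seq; [exact: exec_push|rewrite /upd /=; exact: exec_push].
  by rewrite /upd /= !rev_cons !cat_rcons; apply: IH.
apply: exec_seq; first exact: exec_pour; rewrite /upd /= cats0.
by have := @exec_pour rA rD [:: [::]; [::]; o; tree_bits v ++ d; rev (tree_bits v); [::]; [::]];
   rewrite /upd /= revK; apply.
Qed.

(** The code replaces the tree on top of [rD] by its image. For a pair the second component is
    computed first, since the first must end on top; the last bit pushed is the tag of the node. *)
Fixpoint code_of (f : fn) : cmd :=
  match f with
  | FId => Skip
  | FComp f g => code_of g ;; code_of f
  | FPair f g => dup_tree ;; code_of g ;; swap_tree ;; code_of f ;; Push rD true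
  | FFst => If rD top1 (Pop rD ;; swap_tree ;; drop_tree) Skip
  | FSnd => If rD top1 (Pop rD ;; drop_tree) Skip
  | FLeaf => drop_tree ;; Push rD false
  | FIf f g h => dup_tree ;; code_of f ;;
      If rD top1 (drop_tree ;; code_of g) (drop_tree ;; code_of h)
  | FWhile f g => dup_tree ;; code_of f ;;
      While rD top1 (drop_tree ;; code_of g ;; dup_tree ;; code_of f) ;; drop_tree
  end.

(** Induction on the evaluation, for every remaining stack [d], because subterms run above saved
    copies of their argument. *)
Lemma ev_exec f v w o d : ev f v w ->
  exec (code_of f) (data o (tree_bits v ++ d)) (data o (tree_bits w ++ d)).
Proof.
move=> h; elim: h d => {f v w} /=.
- by move=> v d; apply: exec_skip.
- by move=> f g v w x _ IH1 _ IH2 d; apply: exec_seq (IH1 d) (IH2 d).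
- move=> f g v a b _ IHf _ IHg d.
  apply: exec_seq (exec_dup _ _ _) _.
  apply: exec_seq (IHg _) _.
  apply: exec_seq (exec_swap _ _ _ _) _.
  apply: exec_seq (IHf _) _.
  by rewrite -catA; apply: exec_push.
- move=> [|a b] d; first by apply: exec_if_false => //; apply: exec_skip.
  apply: exec_if_true => //; apply: exec_seq; first exact: exec_pop.
  rewrite /upd /= -catA; apply: exec_seq (exec_swap _ _ _ _) _; exact: exec_drop.
- move=> [|a b] d; first by apply: exec_if_false => //; apply: exec_skip.
  apply: exec_if_true => //; apply: exec_seq; first exact: exec_pop.
  rewrite /upd /= -catA; exact: exec_drop.
- by move=> v d; apply: exec_seq (exec_drop _ _ _) _; apply: exec_push.
- move=> f g h v a b w _ IHf _ IHg d.
  apply: exec_seq (exec_dup _ _ _) _; apply: exec_seq (IHf _) _.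
  apply: exec_if_true => //.
  exact: exec_seq (exec_drop (Node a b) _ _) (IHg _).
- move=> f g h v w _ IHf _ IHg d.
  apply: exec_seq (exec_dup _ _ _) _; apply: exec_seq (IHf _) _.
  apply: exec_if_false => //.
  exact: exec_seq (exec_drop Leaf _ _) (IHg _).
- move=> f g v _ IHf d.
  apply: exec_seq (exec_dup _ _ _) _; apply: exec_seq (IHf _) _.
  by apply: exec_seq (exec_while_false _ _) (exec_drop Leaf _ _).
- move=> f g v a b w x _ IHf _ IHg _ IHw d.
  apply: exec_seq (exec_dup _ _ _) _; apply: exec_seq (IHf _) _.
  (* The execution from [w] is cut into its first test, its loop and the final drop; one more round
     of the loop is then put in front. *)
  move: (IHw d) => hw; inversion hw as [| | |? ? ? s1 ? h1 h2| | | |]; subst.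
  inversion h2 as [| | |? ? ? s2 ? h3 h4| | | |]; subst.
  inversion h4 as [| | |? ? ? s3 ? h5 h6| | | |]; subst.
  apply: exec_seq h6; apply: exec_while_true h5; first by [].
  apply: exec_seq (exec_drop (Node a b) _ _) _.
  apply: exec_seq (IHg _) _.
  exact: exec_seq h1 h3.
Qed.

(** * Conversion between strings on tapes and trees *)

Definition tree_of_bool (b : bool) : tree := if b then Node Leaf Leaf else Leaf.
Definition tree_of_bits (s : bitseq) : tree :=
  foldr (fun b v => Node (tree_of_bool b) v) Leaf s.

(** A list is built from its end, so the last bit must come first; pouring into [rA] brings it to
    the top. The bit true is the tree with notation 1, 0, 0, pushed backwards. *)
Definition load (i : 'I_7) : cmd :=
  pour i rA ;; Push rD false ;;
  While rA nonempty
    (If rA top1 (Push rD false ;; Push rD false ;; Push rD true) (Push rD false) ;;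
     Push rD true ;; Pop rA).

Lemma exec_load_loop x y p u o d :
  exec (While rA nonempty
    (If rA top1 (Push rD false ;; Push rD false ;; Push rD true) (Push rD false) ;;
     Push rD true ;; Pop rA))
    [:: p; u; o; tree_bits (tree_of_bits y) ++ d; x; [::]; [::]]
    [:: p; u; o; tree_bits (tree_of_bits (rev x ++ y)) ++ d; [::]; [::]; [::]].
Proof.
elim: x y => [|b x IH] y; first exact: exec_while_false.
rewrite rev_cons cat_rcons; apply: exec_while_true (IH _) => //.
case: b.
  apply: exec_seq.
    apply: exec_if_true => //.
    apply: exec_seq; first exact: exec_push.
    apply: exec_seq; first exact: exec_push.
    exact: exec_push.
  rewrite /upd /=.
  apply: exec_seq; first exact: exec_push; exact: exec_pop.
apply: exec_seq.
  apply: exec_if_false => //; exact: exec_push.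
rewrite /upd /=.
apply: exec_seq; first exact: exec_push; exact: exec_pop.
Qed.

(** The condition is loaded first so that the program lies on top; the last bit joins them into a
    pair. *)
Definition load_inputs : cmd := load rU ;; load rP ;; Push rD true.

Lemma exec_load_inputs p u :
  exec load_inputs [:: p; u; [::]; [::]; [::]; [::]; [::]]
    (data [::] (tree_bits (Node (tree_of_bits p) (tree_of_bits u)))).
Proof.
apply: exec_seq.
  apply: exec_seq; first exact: exec_pour.
  apply: exec_seq; first exact: exec_push.
  rewrite /upd /= cats0; exact: (exec_load_loop _ [::]).
rewrite revK !cats0.
apply: exec_seq.
  apply: exec_seq; first exact: exec_pour.
  apply: exec_seq; first exact: exec_push.
  rewrite /upd /= cats0; exact: (exec_load_loop _ [::]).
rewrite revK !cats0; exact: exec_push.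
Qed.

Definition unload : cmd :=
  While rD top1 (Pop rD ;;
    If rD top1 (Pop rD ;; Pop rD ;; Pop rD ;; Push rA true) (Pop rD ;; Push rA false)) ;;
  pour rA rO.

Lemma exec_unload x :
  exec unload (data [::] (tree_bits (tree_of_bits x)))
    [:: [::]; [::]; x; [:: false]; [::]; [::]; [::]].
Proof.
apply: (@exec_seq _ _ _ [:: [::]; [::]; [::]; [:: false]; rev x; [::]; [::]]); last first.
  have := @exec_pour rA rO [:: [::]; [::]; [::]; [:: false]; rev x; [::]; [::]].
  by rewrite /upd /= revK cats0; apply.
have loop a : exec (While rD top1 (Pop rD ;;
    If rD top1 (Pop rD ;; Pop rD ;; Pop rD ;; Push rA true) (Pop rD ;; Push rA false)))
    [:: [::]; [::]; [::]; tree_bits (tree_of_bits x); a; [::]; [::]]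
    [:: [::]; [::]; [::]; [:: false]; rev x ++ a; [::]; [::]];
  last by have := loop [::]; rewrite cats0.
elim: x a => [|b x IH] a; first exact: exec_while_false.
apply: (exec_while_true (s2 := [:: [::]; [::]; [::]; tree_bits (tree_of_bits x);
    b :: a; [::]; [::]])) => //; last by rewrite rev_cons cat_rcons.
apply: exec_seq; first exact: exec_pop; rewrite /upd /=.
case: b.
  apply: exec_if_true => //.
  do 3 (apply: exec_seq; first exact: exec_pop); exact: exec_push.
apply: exec_if_false => //.
apply: exec_seq; first exact: exec_pop; exact: exec_push.
Qed.

Definition TM_of_fn (f : fn) : TM :=
  TM_of_machine (compile (load_inputs ;; code_of f ;; unload)).

Lemma ev_computes f p u x :
  ev f (Node (tree_of_bits p) (tree_of_bits u)) (tree_of_bits x) ->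
  computes (TM_of_fn f) p u x.
Proof.
move=> h.
apply: (exec_computes (s' := [:: [::]; [::]; x; [:: false]; [::]; [::]; [::]])).
apply: exec_seq (exec_load_inputs _ _) _.
apply: exec_seq (exec_unload x).
by have := ev_exec [::] [::] h; rewrite !cats0.
Qed.

(** * Computable functions between encoded types *)

#[local] Obligation Tactic := idtac.

Class Code (T : Type) := { code : T -> tree; code_inj : injective code }.

#[export] Typeclasses Transparent bitseq.

#[export] Program Instance Code_tree : Code tree := {| code := id |}.
Next Obligation. by []. Qed.

#[export] Program Instance Code_unit : Code unit := {| code := fun _ => Leaf |}.
Next Obligation. by case=> -[]. Qed.

#[export] Program Instance Code_bool : Code bool := {| code := tree_of_bool |}.
Next Obligation. by case=> -[]. Qed.

(** Unary numerals suffice, as running time does not matter. *)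
#[export] Program Instance Code_nat : Code nat := {| code := fun n => iter n (Node Leaf) Leaf |}.
Next Obligation. by elim=> [|n IH] [|m] //= [] /IH ->. Qed.

#[export] Program Instance Code_prod A B (cA : Code A) (cB : Code B) : Code (A * B) :=
  {| code := fun x => Node (code x.1) (code x.2) |}.
Next Obligation. by move=> A B cA cB [a b] [a' b'] /= [] /(@code_inj _ cA) -> /(@code_inj _ cB) ->. Qed.

#[export] Program Instance Code_seq A (cA : Code A) : Code (seq A) :=
  {| code := fun s => foldr (fun a v => Node (code a) v) Leaf s |}.
Next Obligation. by move=> A cA; elim=> [|a s IH] [|b t] //= [] /(@code_inj _ cA) -> /IH ->. Qed.

Definition tree_of_option A (f : A -> tree) (o : option A) : tree :=
  if o is Some a then Node (f a) Leaf else Leaf.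

#[export] Program Instance Code_option A (cA : Code A) : Code (option A) :=
  {| code := tree_of_option code |}.
Next Obligation. by move=> A cA; case=> [a|]; case=> [b|] //= [e]; rewrite (@code_inj _ cA _ _ e). Qed.

Definition computable A B {cA : Code A} {cB : Code B} (f : A -> B) : Prop :=
  exists p, forall a, ev p (code a) (code (f a)).

Section Closure.
Context A B C T S (cA : Code A) (cB : Code B) (cC : Code C) (cT : Code T) (cS : Code S).

Lemma comp_ext (f g : A -> B) : f =1 g -> computable f -> computable g.
Proof. by move=> e [p hp]; exists p => a; rewrite -e. Qed.

Lemma comp_id : computable (fun a : A => a).
Proof. by exists FId => a; apply: ev_id. Qed.

Lemma comp_cst (b : B) : computable (fun _ : A => b).
Proof.
suff [p hp] : exists p, forall v, ev p v (@code B cB b) by exists p.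
elim: (@code B cB b) => [|v [p hp] w [q hq]]; first by exists FLeaf => v; apply: ev_leaf.
by exists (FPair p q) => x; apply: ev_pair.
Qed.

Lemma comp_comp (f : A -> B) (g : B -> C) :
  computable g -> computable f -> computable (fun a => g (f a)).
Proof. by move=> [p hp] [q hq]; exists (FComp p q) => a; apply: ev_comp (hq a) (hp _). Qed.

Lemma comp_pair (f : A -> B) (g : A -> C) :
  computable f -> computable g -> computable (fun a => (f a, g a)).
Proof. by move=> [p hp] [q hq]; exists (FPair p q) => a; apply: ev_pair. Qed.

Lemma comp_fst (f : A -> B * C) : computable f -> computable (fun a => (f a).1).
Proof.
by move=> [p hp]; exists (FComp FFst p) => a; apply: ev_comp (hp a) (ev_fst (code (f a))).
Qed.

Lemma comp_snd (f : A -> B * C) : computable f -> computable (fun a => (f a).2).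
Proof.
by move=> [p hp]; exists (FComp FSnd p) => a; apply: ev_comp (hp a) (ev_snd (code (f a))).
Qed.

Lemma comp_if (c : A -> bool) (f g : A -> B) :
  computable c -> computable f -> computable g -> computable (fun a => if c a then f a else g a).
Proof.
move=> [p hp] [q hq] [r hr]; exists (FIf p q r) => a; move: (hp a).
by case: (c a) => h; [apply: ev_if_node h _ | apply: ev_if_leaf h _].
Qed.

Lemma comp_lmatch (l : A -> seq T) (f : A -> T -> seq T -> B) (g : A -> B) :
  computable l -> computable (fun x : A * (T * seq T) => f x.1 x.2.1 x.2.2) -> computable g ->
  computable (fun a => if l a is x :: r then f a x r else g a).
Proof.
move=> [p hp] [q hq] [r hr].
exists (FIf p (FComp q (FPair FId p)) r) => a; move: (hp a).
case: (l a) => [|x s] h; first by apply: ev_if_leaf h _.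
apply: ev_if_node (h) _; apply: ev_comp (hq (a, (x, s))).
by apply: ev_pair; [apply: ev_id|].
Qed.

Lemma comp_omatch (l : A -> option T) (f : A -> T -> B) (g : A -> B) :
  computable l -> computable (fun x : A * T => f x.1 x.2) -> computable g ->
  computable (fun a => if l a is Some x then f a x else g a).
Proof.
move=> [p hp] [q hq] [r hr].
exists (FIf p (FComp q (FPair FId (FComp FFst p))) r) => a; move: (hp a).
case: (l a) => [x|] h; last by apply: ev_if_leaf h _.
apply: ev_if_node (h) _; apply: ev_comp (hq (a, x)).
by apply: ev_pair; [apply: ev_id|apply: ev_comp h (ev_fst _)].
Qed.

Lemma comp_cons (f : A -> T) (g : A -> seq T) :
  computable f -> computable g -> computable (fun a => f a :: g a).
Proof. by move=> [p hp] [q hq]; exists (FPair p q) => a; apply: ev_pair. Qed.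

Lemma comp_some (f : A -> T) : computable f -> computable (fun a => Some (f a)).
Proof.
by move=> [p hp]; exists (FPair p FLeaf) => a; apply: ev_pair => //; apply: ev_leaf.
Qed.

Lemma comp_succ (f : A -> nat) : computable f -> computable (fun a => (f a).+1).
Proof.
by move=> [p hp]; exists (FPair FLeaf p) => a; apply: ev_pair => //; apply: ev_leaf.
Qed.

Lemma comp_pred (f : A -> nat) : computable f -> computable (fun a => (f a).-1).
Proof.
move=> [p hp]; exists (FComp FSnd p) => a.
by have := ev_comp (hp a) (ev_snd _); case: (f a).
Qed.

End Closure.

Ltac cstep_core := lazymatch goal with
  | |- @computable _ _ _ _ (fun x => x) => refine (comp_id _)
  | |- @computable _ _ _ _ (fun _ => ?b) => refine (comp_cst _ _ b)
  | |- @computable _ _ _ _ (fun x => (@?f x, @?g x)) => refine (@comp_pair _ _ _ _ _ _ f g _ _)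
  | |- @computable _ _ _ _ (fun x => fst (@?f x)) => refine (@comp_fst _ _ _ _ _ _ f _)
  | |- @computable _ _ _ _ (fun x => snd (@?f x)) => refine (@comp_snd _ _ _ _ _ _ f _)
  | |- @computable _ _ _ _ (fun x => @?f x :: @?g x) => refine (@comp_cons _ _ _ _ f g _ _)
  | |- @computable _ _ _ _ (fun x => Some (@?f x)) => refine (@comp_some _ _ _ _ f _)
  | |- @computable _ _ _ _ (fun x => (@?f x).+1) => refine (@comp_succ _ _ f _)
  | |- @computable _ _ _ _ (fun x => (@?f x).-1) => refine (@comp_pred _ _ f _)
  | |- @computable _ _ _ _ (@fst _ _) => refine (@comp_fst _ _ _ _ _ _ id (comp_id _))
  | |- @computable _ _ _ _ (@snd _ _) => refine (@comp_snd _ _ _ _ _ _ id (comp_id _))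
  | _ => first [eapply comp_if | eapply comp_lmatch | eapply comp_omatch]
  end.
Ltac comp_auto := cbn beta; repeat (first [assumption | cstep_core]; cbn beta).

(** A while loop whose state consists of the parameter, the unread part of the list and the
    accumulator; it ends when the unread part is a leaf. *)
Lemma comp_foldl A T S (cA : Code A) (cT : Code T) (cS : Code S)
    (h : A -> S -> T -> S) (z : A -> S) (l : A -> seq T) :
  computable (fun x : A * (S * T) => h x.1 x.2.1 x.2.2) -> computable z -> computable l ->
  computable (fun a => foldl (h a) (z a) (l a)).
Proof.
move=> hh [pz hz] [pl hl].
have [pb hb] : exists p, forall a x r s,
    ev p (code (a, (x :: r, s))) (code (a, (r, h a s x))).
  pose h' := fun y : A * ((T * seq T) * S) => (y.1, (y.2.1.2, h y.1 y.2.2 y.2.1.1)).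
  have [p hp] : computable h'.
    apply: comp_pair; first by comp_auto.
    apply: comp_pair; first by comp_auto.
    have := comp_comp (f := fun y : A * ((T * seq T) * S) => (y.1, (y.2.2, y.2.1.1))) hh.
    by apply; comp_auto.
  by exists p => a x r s; apply: (hp (a, ((x, r), s))).
exists (FComp (FComp FSnd FSnd) (FComp (FWhile (FComp FFst FSnd) pb) (FPair FId (FPair pl pz)))).
move=> a; apply: ev_comp.
  apply: ev_comp.
    by apply: ev_pair (ev_id _) _; apply: ev_pair.
  have : forall s, ev (FWhile (FComp FFst FSnd) pb) (code (a, (l a, s)))
      (code (a, ([::] : seq T, foldl (h a) s (l a)))).
    elim: (l a) => [|x r IH] s.
      by apply: ev_while_leaf; apply: ev_comp (ev_snd _) (ev_fst _).
    apply: ev_while_node (hb a x r s) (IH _).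
    by apply: ev_comp (ev_snd _) (ev_fst _).
  by apply.
by apply: ev_comp (ev_snd _) (ev_snd _).
Qed.

Lemma comp_iter A S (cA : Code A) (cS : Code S) (n : A -> nat) (f : A -> S -> S) (z : A -> S) :
  computable n -> computable (fun x : A * S => f x.1 x.2) -> computable z ->
  computable (fun a => iter (n a) (f a) (z a)).
Proof.
move=> hn hf hz.
have hl : computable (fun a => nseq (n a) tt).
  case: hn => p hp; exists p => a; move: (hp a); congr ev.
  by elim: (n a) => //= k ->.
apply: comp_ext (comp_foldl (h := fun a s _ => f a s) _ hz hl).
  by move=> a /=; elim: (n a) (z a) => //= k IH s; rewrite IH -iterSr.
have := comp_comp (f := fun x : A * (S * unit) => (x.1, x.2.1)) hf.
by apply; comp_auto.
Qed.

(** Unbounded search. The number of rounds has no bound known in advance, so correctness is claimed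
    only for those inputs on which the loop ends. *)
Lemma comp_while S (cS : Code S) (c : S -> bool) (f : S -> S) :
  computable c -> computable f -> exists p, forall s n,
    (forall k, k < n -> c (iter k f s)) -> ~~ c (iter n f s) ->
    ev p (code s) (code (iter n f s)).
Proof.
move=> [pc hc] [pf hf]; exists (FWhile pc pf) => s n.
elim: n s => [|n IH] s hk hn.
  by apply: ev_while_leaf; move: (hc s); rewrite (negbTE hn).
move: (hc s); rewrite (hk 0) // => h0.
apply: ev_while_node h0 (hf s) _; rewrite iterSr; apply: IH.
  by move=> k kn; rewrite -iterSr; apply: hk.
by rewrite -iterSr.
Qed.

(** * Equality tests, list operations and arithmetic *)

Fixpoint eq_tree (v w : tree) : bool :=
  match v, w with
  | Leaf, Leaf => true
  | Node a b, Node a' b' => eq_tree a a' && eq_tree b b'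
  | _, _ => false
  end.

Lemma eq_treeP v w : reflect (v = w) (eq_tree v w).
Proof.
elim: v w => [|a IHa b IHb] [|a' b'] /=; try by constructor.
by apply: (iffP andP) => [[/IHa -> /IHb ->]|[<- <-]] //; split; [apply/IHa|apply/IHb].
Qed.

Fixpoint tree_size (v : tree) : nat :=
  if v is Node a b then (tree_size a + tree_size b).+1 else 1.

Definition is_node (v : tree) := if v is Node _ _ then true else false.

Lemma comp_is_node A (cA : Code A) (f : A -> tree) :
  computable f -> computable (fun a => is_node (f a)).
Proof.
move=> [p hp]; exists (FIf p (FPair FLeaf FLeaf) FLeaf) => a; move: (hp a).
case: (f a) => [|v w] h; first by apply: ev_if_leaf h (ev_leaf _).
by apply: ev_if_node h _; apply: ev_pair; apply: ev_leaf.
Qed.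

Lemma comp_tree_fst A (cA : Code A) (f : A -> tree) :
  computable f -> computable (fun a => tree_fst (f a)).
Proof. by move=> [p hp]; exists (FComp FFst p) => a; apply: ev_comp (hp a) (ev_fst _). Qed.

Lemma comp_tree_snd A (cA : Code A) (f : A -> tree) :
  computable f -> computable (fun a => tree_snd (f a)).
Proof. by move=> [p hp]; exists (FComp FSnd p) => a; apply: ev_comp (hp a) (ev_snd _). Qed.

(** Recursion on two trees is replaced by a worklist of pairs still to be compared; a mismatch
    empties the list at once. *)
Definition eq_step (x : seq (tree * tree) * bool) : seq (tree * tree) * bool :=
  if x.1 is y :: W then
    if is_node y.1 then
      if is_node y.2 then
        ((tree_fst y.1, tree_fst y.2) :: (tree_snd y.1, tree_snd y.2) :: W, x.2)
      else ([::], false)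
    else if is_node y.2 then ([::], false) else (W, x.2)
  else x.

(** The total size of the first components decreases at each step, since a node gives way to its two
    subtrees. *)
Lemma eq_step_run W b : exists n,
  (forall k, k < n -> ~~ nilp (iter k eq_step (W, b)).1) /\
  iter n eq_step (W, b) = ([::], b && all (fun y => eq_tree y.1 y.2) W).
Proof.
move em : (\sum_(y <- W) tree_size y.1) => m.
elim/ltn_ind: m W b em => m IH [|[v w] W] b em.
  by exists 0; rewrite andbT.
have stop x : eq_step ((v, w) :: W, b) = ([::], false) ->
    x = false -> exists n, (forall k, k < n -> ~~ nilp (iter k eq_step ((v, w) :: W, b)).1) /\
  iter n eq_step ((v, w) :: W, b) = ([::], x).
  by move=> e ->; exists 1; split=> [[]|] //=.
have go W' : eq_step ((v, w) :: W, b) = (W', b) ->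
    \sum_(y <- W') tree_size y.1 < m ->
    exists n, (forall k, k < n -> ~~ nilp (iter k eq_step ((v, w) :: W, b)).1) /\
  iter n eq_step ((v, w) :: W, b) = ([::], b && all (fun y => eq_tree y.1 y.2) W').
  move=> e lt; have [n [h1 h2]] := IH _ lt W' b erefl.
  by exists n.+1; split=> [[|k] //|]; rewrite iterSr e //; apply: h1.
move: em; rewrite big_cons /= => em.
case: v w em stop go => [|v1 v2] [|w1 w2] /= em stop go.
- by apply: go => //; lia.
- by apply: stop => //; rewrite andbF.
- by apply: stop => //; rewrite andbF.
- rewrite -andbA; apply: (go ((v1, w1) :: (v2, w2) :: W)) => //.
  by rewrite !big_cons /=; lia.
Qed.

Lemma comp_eq A (T : eqType) (cA : Code A) (cT : Code T) (f g : A -> T) :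
  computable f -> computable g -> computable (fun a => f a == g a).
Proof.
have hn : computable (fun x : seq (tree * tree) * bool => ~~ nilp x.1).
  apply: (@comp_ext _ _ _ _ (fun x => if x.1 is _ :: _ then true else false)).
    by move=> [[]].
  by comp_auto.
have hs : computable eq_step.
  have e : computable (fun x : seq (tree * tree) * bool => if x.1 is y :: W then
    if is_node y.1 then
      if is_node y.2 then
        ((tree_fst y.1, tree_fst y.2) :: (tree_snd y.1, tree_snd y.2) :: W, x.2)
      else ([::], false)
    else if is_node y.2 then ([::], false) else (W, x.2)
  else x).
    cbn beta; repeat (first [cstep_core | apply: comp_is_node | apply: comp_tree_fst
      | apply: comp_tree_snd]; cbn beta).
  exact: e.
have [p hp] := comp_while hn hs.
move=> [q hq] [r hr].
exists (FComp FSnd (FComp p (FPair (FPair (FPair q r) FLeaf) (FPair FLeaf FLeaf)))).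
move=> a; have [n [h1 h2]] := eq_step_run [:: (code (f a), code (g a))] true.
apply: ev_comp; last first.
  have -> : (f a == g a) = (iter n eq_step ([:: (code (f a), code (g a))], true)).2.
    by rewrite h2 /= andbT; apply/eqP/eq_treeP => [-> //|e]; apply: (@code_inj _ cT).
  exact: (ev_snd (code (iter n eq_step ([:: (code (f a), code (g a))], true)))).
apply: ev_comp (hp _ _ h1 _); last by rewrite h2.
by do ?[apply: ev_pair | apply: ev_leaf].
Qed.

Section ListClosure.
Context A T S (cA : Code A) (cT : Code T) (cS : Code S).

Lemma comp_and (f g : A -> bool) :
  computable f -> computable g -> computable (fun a => f a && g a).
Proof. by move=> hf hg; have := comp_if hf hg (comp_cst _ _ false). Qed.

Lemma comp_head (d : T) (l : A -> seq T) : computable l -> computable (fun a => head d (l a)).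
Proof.
by move=> hl; apply: (@comp_lmatch _ _ _ _ _ _ l (fun _ x _ => x) (fun=> d)); comp_auto.
Qed.

Lemma comp_behead (l : A -> seq T) : computable l -> computable (fun a => behead (l a)).
Proof.
by move=> hl; apply: (@comp_lmatch _ _ _ _ _ _ l (fun _ _ r => r) (fun=> [::])); comp_auto.
Qed.

Lemma comp_catrev (f g : A -> seq T) :
  computable f -> computable g -> computable (fun a => catrev (f a) (g a)).
Proof.
move=> hf hg; apply: comp_ext (comp_foldl (h := fun _ s x => x :: s) _ hg hf); last by comp_auto.
by move=> a /=; elim: (f a) (g a) => //= x r IH s; rewrite IH.
Qed.

Lemma comp_rev (f : A -> seq T) : computable f -> computable (fun a => rev (f a)).
Proof. by move=> hf; apply: comp_catrev hf (comp_cst _ _ _). Qed.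
End ListClosure.

Section ListClosure2.
Context A T S (cA : Code A) (cT : Code T) (cS : Code S).

Lemma comp_cat (f g : A -> seq T) :
  computable f -> computable g -> computable (fun a => f a ++ g a).
Proof.
move=> hf hg; apply: comp_ext (comp_catrev (comp_rev hf) hg) => a.
by rewrite catrevE revK.
Qed.

Lemma comp_foldr (h : A -> T -> S -> S) (z : A -> S) (l : A -> seq T) :
  computable (fun x : A * (T * S) => h x.1 x.2.1 x.2.2) -> computable z -> computable l ->
  computable (fun a => foldr (h a) (z a) (l a)).
Proof.
move=> hh hz hl.
apply: (comp_ext _ (comp_foldl (h := fun a s x => h a x s) _ hz (comp_rev hl))).
  by move=> a /=; rewrite foldl_rev.
by apply: (comp_comp (f := fun x : A * (S * T) => (x.1, (x.2.2, x.2.1))) hh); comp_auto.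
Qed.


End ListClosure2.

Section MapClosure.
Context A T S (cA : Code A) (cT : Code T) (cS : Code S).

Lemma comp_map (h : A -> T -> S) (l : A -> seq T) :
  computable (fun x : A * T => h x.1 x.2) -> computable l -> computable (fun a => map (h a) (l a)).
Proof.
move=> hh hl.
apply: comp_ext (comp_foldr (h := fun a x s => h a x :: s) _ (comp_cst _ _ [::]) hl).
  by move=> a; elim: (l a) => //= x r ->.
apply: comp_cons; last by comp_auto.
by apply: (comp_comp (f := fun x : A * (T * seq S) => (x.1, x.2.1)) hh); comp_auto.
Qed.
End MapClosure.

Section ListClosure3.
Context A T (cA : Code A) (cT : Code T).

Lemma comp_foldr' S (cS : Code S) (h : A -> T -> S -> S) (z : S) (l : A -> seq T) :
  computable (fun x : A * T * S => h x.1.1 x.1.2 x.2) -> computable l ->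
  computable (fun a => foldr (h a) z (l a)).
Proof.
move=> hh hl; apply: comp_foldr (comp_cst _ _ _) hl.
by apply: (comp_comp (f := fun x : A * (T * S) => (x.1, x.2.1, x.2.2)) hh); comp_auto.
Qed.

Lemma comp_weaken S X (cS : Code S) (cX : Code X) (h : A -> T -> S) :
  computable (fun x : A * T => h x.1 x.2) -> computable (fun x : A * T * X => h x.1.1 x.1.2).
Proof.
move=> hh; apply: (comp_comp (f := fun x : A * T * X => (x.1.1, x.1.2)) hh); comp_auto.
Qed.

Lemma comp_filter (h : A -> T -> bool) (l : A -> seq T) :
  computable (fun x : A * T => h x.1 x.2) -> computable l -> computable (fun a => filter (h a) (l a)).
Proof.
move=> hh hl.
apply: comp_ext (@comp_foldr' _ _ (fun a x s => if h a x then x :: s else s) [::] l _ hl).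
  by move=> a; elim: (l a) => //= x r ->.
by apply: comp_if; comp_auto; apply: comp_weaken hh.
Qed.

Lemma comp_has (h : A -> T -> bool) (l : A -> seq T) :
  computable (fun x : A * T => h x.1 x.2) -> computable l -> computable (fun a => has (h a) (l a)).
Proof.
move=> hh hl.
apply: comp_ext (@comp_foldr' _ _ (fun a x s => if h a x then true else s) false l _ hl).
  by move=> a; elim: (l a) => //= x r ->.
by apply: comp_if; comp_auto; apply: comp_weaken hh.
Qed.

Lemma comp_all (h : A -> T -> bool) (l : A -> seq T) :
  computable (fun x : A * T => h x.1 x.2) -> computable l -> computable (fun a => all (h a) (l a)).
Proof.
move=> hh hl.
apply: comp_ext (@comp_foldr' _ _ (fun a x s => if h a x then s else false) true l _ hl).
  by move=> a; elim: (l a) => //= x r ->.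
by apply: comp_if; comp_auto; apply: comp_weaken hh.
Qed.

Lemma comp_flatten (l : A -> seq (seq T)) : computable l -> computable (fun a => flatten (l a)).
Proof.
move=> hl; apply: (comp_foldr (h := fun _ x s => x ++ s) _ (comp_cst _ _ [::]) hl).
by apply: comp_cat; comp_auto.
Qed.

Lemma comp_size (l : A -> seq T) : computable l -> computable (fun a => size (l a)).
Proof.
move=> hl; apply: comp_ext (comp_foldr (h := fun _ _ n => n.+1) _ (comp_cst _ _ 0) hl).
  by move=> a; elim: (l a) => //= x r ->.
by comp_auto.
Qed.

Lemma comp_nth (d : T) (l : A -> seq T) (n : A -> nat) :
  computable l -> computable n -> computable (fun a => nth d (l a) (n a)).
Proof.
move=> hl hn.
apply: (comp_ext _ (comp_head d (comp_iter (f := fun _ => behead) hn _ hl))).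
  move=> a; elim: (n a) (l a) => [|k IH] [|x r] //; rewrite iterSr ?IH //=.
  by rewrite nth_nil.
by apply: comp_behead; comp_auto.
Qed.

Lemma comp_take (l : A -> seq T) (n : A -> nat) :
  computable l -> computable n -> computable (fun a => take (n a) (l a)).
Proof.
move=> hl hn.
(* The state is the part taken so far, reversed, together with the rest of the list. *)
pose f (x : seq T * seq T) := if x.2 is y :: r then (y :: x.1, r) else x.
have hf : computable f by rewrite /f; comp_auto.
have h0 : computable (fun a => ([::] : seq T, l a)) by comp_auto.
have hi : computable (fun a => iter (n a) f ([::], l a)).
  apply: (comp_iter (f := fun _ => f) hn _ h0).
  by apply: (comp_comp (f := fun x : A * (seq T * seq T) => x.2) hf); comp_auto.
apply: comp_ext (comp_rev (comp_fst hi)) => a.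
suff e m : forall acc s, (iter m f (acc, s)).1 = rev (take m s) ++ acc.
  by rewrite e cats0 revK.
by elim: m => [|m IH] acc [|y r] //; rewrite iterSr IH //= rev_cons cat_rcons.
Qed.
End ListClosure3.

Section EqClosure.
Context A (T : eqType) (cA : Code A) (cT : Code T).

Lemma comp_mem (f : A -> T) (l : A -> seq T) :
  computable f -> computable l -> computable (fun a => f a \in l a).
Proof.
move=> hf hl; apply: comp_ext (comp_has (h := fun a y => y == f a) _ hl).
  by move=> a; rewrite has_pred1.
apply: comp_eq; first by comp_auto.
by apply: (comp_comp (f := fun x : A * T => x.1) hf); comp_auto.
Qed.
End EqClosure.

(* [undup] keeps last occurrences; here later items never disturb earlier ones. *)
Definition nub (T : eqType) (s : seq T) : seq T :=
  foldl (fun acc y => if y \in acc then acc else rcons acc y) [::] s.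

Lemma comp_nub A (T : eqType) (cA : Code A) (cT : Code T) (l : A -> seq T) :
  computable l -> computable (fun a => nub (l a)).
Proof.
move=> hl; apply: (comp_foldl (h := fun _ acc y => _) _ (comp_cst _ _ [::]) hl).
apply: comp_if; first by apply: comp_mem; comp_auto.
  by comp_auto.
apply: (comp_ext (f := fun x : A * (seq T * T) => x.2.1 ++ [:: x.2.2])).
  by move=> x; rewrite cats1.
by apply: comp_cat; comp_auto.
Qed.

Section NatClosure.
Context A (cA : Code A).
Implicit Types m n : A -> nat.

Lemma comp_sub m n : computable m -> computable n -> computable (fun a => m a - n a).
Proof.
move=> hm hn; apply: (comp_ext _ (comp_iter (f := fun _ => predn) hn _ hm)).
  by move=> a /=; elim: (n a) => [|k IH] /=; rewrite ?subn0 // IH subnS.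
by comp_auto.
Qed.

Lemma comp_add m n : computable m -> computable n -> computable (fun a => m a + n a).
Proof.
move=> hm hn; apply: (comp_ext _ (comp_iter (f := fun _ => succn) hn _ hm)).
  by move=> a /=; elim: (n a) => [|k IH] /=; rewrite ?addn0 // IH addnS.
by comp_auto.
Qed.

Lemma comp_leq m n : computable m -> computable n -> computable (fun a => m a <= n a).
Proof. by move=> hm hn; apply: comp_eq (comp_sub hm hn) (comp_cst _ _ 0). Qed.

End NatClosure.

Section NatClosure2.
Context A (cA : Code A).
Implicit Types n : A -> nat.

Lemma comp_pow2 n : computable n -> computable (fun a => 2 ^ n a).
Proof.
move=> hn; apply: (comp_ext _ (comp_iter (f := fun _ k => k + k) hn _ (comp_cst _ _ 1))).
  by move=> a /=; elim: (n a) => [|k IH] //=; rewrite IH expnS mul2n addnn.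
by apply: comp_add; comp_auto.
Qed.

Lemma comp_iota n : computable n -> computable (fun a => iota 0 (n a)).
Proof.
move=> hn.
apply: (comp_ext _ (comp_iter (f := fun _ l => l ++ [:: size l]) hn _ (comp_cst _ _ [::]))).
  move=> a; elim: (n a) => [|k IH] //; rewrite iterS IH size_iota -addn1 iotaD //.
apply: comp_cat; first by comp_auto.
by apply: comp_cons; [apply: comp_size|]; comp_auto.
Qed.
End NatClosure2.

(** * Decoding strings *)

(* A hook tried first, so that functions added to it are not unfolded. *)
Ltac comp_user := fail.

Ltac comp_step := first [assumption | comp_user | lazymatch goal with
  | |- @computable _ _ _ _ (fun _ => ?b) => refine (comp_cst _ _ b)
  | |- @computable _ _ _ _ (fun x => @?f x == @?g x) => refine (@comp_eq _ _ _ _ f g _ _)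
  | |- @computable _ _ _ _ (fun x => @?f x && @?g x) => refine (@comp_and _ _ f g _ _)
  | |- @computable _ _ _ _ (fun x => @?f x \in @?g x) => refine (@comp_mem _ _ _ _ f g _ _)
  | |- @computable _ _ _ _ (fun x => foldl (@?h x) (@?z x) (@?l x)) =>
       refine (@comp_foldl _ _ _ _ _ _ h z l _ _ _)
  | |- @computable _ _ _ _ (fun x => foldr (@?h x) (@?z x) (@?l x)) =>
       refine (@comp_foldr _ _ _ _ _ _ h z l _ _ _)
  | |- @computable _ _ _ _ (fun x => iter (@?n x) (@?h x) (@?z x)) =>
       refine (@comp_iter _ _ _ _ n h z _ _ _)
  | |- @computable _ _ _ _ (fun x => head ?d (@?l x)) => refine (@comp_head _ _ _ _ d l _)
  | |- @computable _ _ _ _ (fun x => behead (@?l x)) => refine (@comp_behead _ _ _ _ l _)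
  | |- @computable _ _ _ _ (fun x => rev (@?l x)) => refine (@comp_rev _ _ _ _ l _)
  | |- @computable _ _ _ _ (fun x => @?f x ++ @?g x) => refine (@comp_cat _ _ _ _ f g _ _)
  | |- @computable _ _ _ _ (fun x => map (@?h x) (@?l x)) => refine (@comp_map _ _ _ _ _ _ h l _ _)
  | |- @computable _ _ _ _ (fun x => filter (@?h x) (@?l x)) => refine (@comp_filter _ _ _ _ h l _ _)
  | |- @computable _ _ _ _ (fun x => has (@?h x) (@?l x)) => refine (@comp_has _ _ _ _ h l _ _)
  | |- @computable _ _ _ _ (fun x => all (@?h x) (@?l x)) => refine (@comp_all _ _ _ _ h l _ _)
  | |- @computable _ _ _ _ (fun x => flatten (@?l x)) => refine (@comp_flatten _ _ _ _ l _)
  | |- @computable _ _ _ _ (fun x => size (@?l x)) => refine (@comp_size _ _ _ _ l _)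
  | |- @computable _ _ _ _ (fun x => nth ?d (@?l x) (@?n x)) => refine (@comp_nth _ _ _ _ d l n _ _)
  | |- @computable _ _ _ _ (fun x => take (@?n x) (@?l x)) => refine (@comp_take _ _ _ _ l n _ _)
  | |- @computable _ _ _ _ (fun x => nub (@?l x)) => refine (@comp_nub _ _ _ _ l _)
  | |- @computable _ _ _ _ (fun x => @?m x <= @?n x) => refine (@comp_leq _ _ m n _ _)
  | |- @computable _ _ _ _ (fun x => @?m x + @?n x) => refine (@comp_add _ _ m n _ _)
  | |- @computable _ _ _ _ (fun x => 2 ^ @?n x) => refine (@comp_pow2 _ _ n _)
  | |- @computable _ _ _ _ (fun x => iota 0 (@?n x)) => refine (@comp_iota _ _ n _)
  | _ => cstep_core end].
Ltac comp_tac := cbn beta; repeat (comp_step; cbn beta).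

(** An automaton: [Some false] awaits a marker, [Some true] awaits a data bit, and in state [None]
    the delimited string has ended and the remainder is copied. Both accumulators are reversed. *)
Definition undelim_step (st : option bool * bitseq * bitseq) (b : bool) :=
  if st.1.1 is Some inside then
    if inside then (Some false, b :: st.1.2, st.2)
    else if b then (Some true, st.1.2, st.2) else (None, st.1.2, st.2)
  else (None, st.1.2, b :: st.2).

Definition undelim (s : bitseq) : bitseq * bitseq :=
  let st := foldl undelim_step (Some false, [::], [::]) s in (rev st.1.2, rev st.2).

Lemma undelimK a r : undelim (delimited a ++ r) = (a, r).
Proof.
rewrite /undelim foldl_cat.
have -> acc : foldl undelim_step (Some false, acc, [::]) (delimited a) =
    (None, rev a ++ acc, [::]).
  by elim: a acc => //= b a IH acc; rewrite IH rev_cons cat_rcons.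
have -> c acc : foldl undelim_step (None, c, acc) r = (None, c, rev r ++ acc).
  by elim: r acc => //= b r IH acc; rewrite IH rev_cons cat_rcons.
by rewrite /= !cats0 !revK.
Qed.

Lemma comp_undelim A (cA : Code A) (f : A -> bitseq) :
  computable f -> computable (fun a => undelim (f a)).
Proof.
move=> hf; have h : computable undelim by rewrite /undelim /undelim_step; comp_tac.
exact: comp_comp h hf.
Qed.

(** Folding over the string itself supplies enough rounds, because each component occupies at least
    one bit; surplus rounds leave the state unchanged. *)
Definition decode_step (st : bitseq * seq bitseq) (_ : bool) :=
  if nilp st.1 then st else ((undelim st.1).2, (undelim st.1).1 :: st.2).

Definition decode (s : bitseq) : seq bitseq := rev (foldl decode_step (s, [::]) s).2.

Lemma decode_step_encode s ss acc b :
  decode_step (encode (s :: ss), acc) b = (encode ss, s :: acc).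
Proof.
have e : undelim (encode (s :: ss)) = (s, encode ss) by rewrite -[encode _]/(_ ++ _) undelimK.
by rewrite /decode_step [(_, _).1]/= e; case: s {e}.
Qed.

Lemma encodeK : cancel encode decode.
Proof.
move=> ss; rewrite /decode.
have : size ss <= size (encode ss).
  elim: ss => //= s ss IH; rewrite /encode /= size_cat.
  by apply: (leq_ltn_trans IH); rewrite -add1n leq_add2r; case: s.
move: {1 3}(encode ss) => x.
suff H acc : size ss <= size x -> (foldl decode_step (encode ss, acc) x).2 = rev ss ++ acc.
  by move=> /H ->; rewrite cats0 revK.
elim: x ss acc => [|b x IH] [|s ss] acc // hs; first exact: (IH [::]).
by rewrite [LHS]/= -/(encode _) decode_step_encode IH // rev_cons cat_rcons.
Qed.

Lemma comp_decode A (cA : Code A) (f : A -> bitseq) :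
  computable f -> computable (fun a => decode (f a)).
Proof.
move=> hf; have h : computable decode.
  rewrite /decode /decode_step; comp_tac; try (apply: comp_undelim; comp_tac).
  by rewrite /nilp; comp_tac.
exact: comp_comp h hf.
Qed.

Definition bits_val (s : bitseq) : nat := foldr (fun (b : bool) n => b + (n + n)) 0 s.

Lemma comp_bits_val A (cA : Code A) (f : A -> bitseq) :
  computable f -> computable (fun a => bits_val (f a)).
Proof.
move=> hf; have h : computable bits_val.
  apply: (@comp_ext _ _ _ _ (foldr (fun (b : bool) n => (if b then 1 else 0) + (n + n)) 0)).
    by elim=> //= -[] s ->.
  have c : computable (fun s : bitseq => foldr (fun (b : bool) n => (if b then 1 else 0) + (n + n)) 0 s).
    by comp_tac.
  exact: c.
exact: comp_comp h hf.
Qed.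

(** Padding with leading zeros gives numerals of a prescribed length; positions in enumerations are
    written in this way. *)
Lemma bits_val_surj k n : n < 2 ^ k -> exists2 s, size s = k & bits_val s = n.
Proof.
elim: k n => [|k IH] n hn; first by exists [::] => //; case: n hn.
have /IH[s hs e] : n./2 < 2 ^ k by move: hn; rewrite expnS; lia.
by exists (odd n :: s); rewrite /= ?hs // e; have := odd_double_half n; lia.
Qed.

Lemma comp_bin_succ A (cA : Code A) (f : A -> bitseq) :
  computable f -> computable (fun a => bin_succ (f a)).
Proof.
(* The fold carries a string together with its successor, as the case of a leading 0 needs the tail
   itself. *)
move=> hf; have h : computable (fun s : bitseq => (foldr (fun (b : bool) (x : bitseq * bitseq) =>
    (b :: x.1, if b then false :: x.2 else true :: x.1)) ([::], [:: true]) s).2).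
  by comp_tac.
have {}h : computable bin_succ.
  apply: comp_ext h => s; set F := foldr _ _.
  suff -> : F s = (s, bin_succ s) by [].
  by elim: s => //= b s ->; case: b.
exact: comp_comp h hf.
Qed.

Lemma comp_binary A (cA : Code A) (f : A -> nat) :
  computable f -> computable (fun a => binary (f a)).
Proof. by move=> hf; rewrite /binary; comp_tac; apply: comp_bin_succ; comp_tac. Qed.

Fixpoint strings (b : nat) : seq bitseq :=
  if b is b'.+1 then [::] :: map (cons true) (strings b') ++ map (cons false) (strings b')
  else [:: [::]].

Lemma mem_strings b p : (p \in strings b) = (size p <= b).
Proof.
elim: b p => [|b IH] p; first by rewrite inE; case: p.
rewrite /= inE mem_cat; case: p => [|c p] //=; rewrite ltnS -IH.
apply/orP/idP => [[/mapP[q hq [_ ->]]|/mapP[q hq [_ ->]]] //|h].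
by case: c; [left|right]; apply: map_f.
Qed.

Lemma size_strings b : size (strings b) < 2 ^ b.+1.
Proof.
elim: b => // b IH.
have -> : size (strings b.+1) = (size (strings b)).*2.+1.
  by rewrite /= size_cat !size_map addnn.
by rewrite expnS; lia.
Qed.

Lemma comp_strings A (cA : Code A) (f : A -> nat) :
  computable f -> computable (fun a => strings (f a)).
Proof.
move=> hf; apply: (@comp_ext _ _ _ _ (fun a => iter (f a)
  (fun l => [::] :: map (cons true) l ++ map (cons false) l) [:: [::]])).
  by move=> a; elim: (f a) => //= k ->.
by comp_tac.
Qed.

Ltac comp_user ::= lazymatch goal with
  | |- @computable _ _ _ _ (fun x => undelim (@?f x)) => refine (@comp_undelim _ _ f _)
  | |- @computable _ _ _ _ (fun x => decode (@?f x)) => refine (@comp_decode _ _ f _)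
  | |- @computable _ _ _ _ (fun x => bits_val (@?f x)) => refine (@comp_bits_val _ _ f _)
  | |- @computable _ _ _ _ (fun x => binary (@?f x)) => refine (@comp_binary _ _ f _)
  | |- @computable _ _ _ _ (fun x => strings (@?f x)) => refine (@comp_strings _ _ f _)
  end.

(** * Simulation of a Turing machine *)

Section Simulation.
Variable U : TM.
Let k := (extra_tapes U).+3.

Definition tape_data := (seq (option bool) * seq (option bool))%type.
Definition cfg_data := (nat * seq tape_data)%type.

Definition data_of_tape (t : tape) : tape_data := (left_part t, right_part t).

Definition data_of_cfg (c : config U) : cfg_data :=
  (val (enum_rank (cfg_state c)), [seq data_of_tape (cfg_tapes c i) | i <- enum 'I_k]).

Definition data_of_dir (d : direction) : option bool :=
  match d with MoveLeft => Some false | MoveRight => Some true | Stay => None end.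

Definition table_key (q : TM_state U) (f : {ffun 'I_k -> option bool}) :=
  (val (enum_rank q), [seq f i | i <- enum 'I_k]).

Definition table_value (q : TM_state U) (f : {ffun 'I_k -> option bool}) :=
  if TM_trans q f is Some (q', act) then
    Some (val (enum_rank q'), [seq ((act i).1, data_of_dir (act i).2) | i <- enum 'I_k])
  else None.

(** The transition function has a finite graph, which becomes a constant of the simulating
    program. *)
Definition table := [seq (table_key x.1 x.2, table_value x.1 x.2)
                    | x : TM_state U * {ffun 'I_k -> option bool}].

Definition lookup (key : nat * seq (option bool)) :=
  head None [seq e.2 | e <- table & e.1 == key].

Lemma enum_ord_map_inj (T : Type) (f g : 'I_k -> T) :
  [seq f i | i <- enum 'I_k] = [seq g i | i <- enum 'I_k] -> f =1 g.
Proof. by move=> /eq_in_map h i; apply: h; rewrite mem_enum. Qed.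

Lemma table_key_inj q f q' f' : table_key q f = table_key q' f' -> (q, f) = (q', f').
Proof.
case=> /val_inj/enum_rank_inj -> /enum_ord_map_inj e.
by congr pair; apply/ffunP.
Qed.

Lemma lookupE q f : lookup (table_key q f) = table_value q f.
Proof.
rewrite /lookup /table /image_mem filter_map -map_comp.
set p := preim _ _.
have -> : [seq x <- enum {: TM_state U * {ffun 'I_k -> option bool}} | p x] = [:: (q, f)].
  rewrite (@eq_filter _ _ (pred1 (q, f))) ?filter_pred1_uniq ?enum_uniq ?mem_enum //.
  move=> [q' f'] /=; apply/eqP/eqP => [/table_key_inj //|[-> ->] //].
by [].
Qed.

Definition sim_next (d : cfg_data) := lookup (d.1, [seq head None t.2 | t <- d.2]).

Definition move_data (a : option bool * option bool) (t : tape_data) : tape_data :=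
  if a.2 is Some r then
    if r then (a.1 :: t.1, behead t.2)
    else (behead t.1, head None t.1 :: a.1 :: behead t.2)
  else (t.1, a.1 :: behead t.2).

Definition sim_step (d : cfg_data) : cfg_data :=
  if sim_next d is Some a then
    (a.1, [seq move_data (nth (None, None) a.2 j) (nth ([::], [::]) d.2 j) | j <- iota 0 k])
  else d.

Lemma map_iota_ord (T : Type) (f : nat -> T) :
  [seq f j | j <- iota 0 k] = [seq f (val i) | i <- enum 'I_k].
Proof. by rewrite -val_enum_ord -map_comp. Qed.

Lemma nth_map_ord (T : Type) (d : T) (f : 'I_k -> T) (i : 'I_k) :
  nth d [seq f j | j <- enum 'I_k] i = f i.
Proof. by rewrite (nth_map i) ?size_enum_ord // nth_ord_enum. Qed.

Lemma sim_nextE (c : config U) : sim_next (data_of_cfg c) = table_value (cfg_state c) (scanned c).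
Proof.
rewrite /sim_next -lookupE; congr lookup; congr pair; rewrite -map_comp.
by apply: eq_map => i /=; rewrite ffunE.
Qed.

Lemma sim_stepE (c : config U) : sim_step (data_of_cfg c) = data_of_cfg (TM_step c).
Proof.
rewrite /sim_step sim_nextE /TM_step /table_value /TM_next.
case: (TM_trans _ _) => [[q act]|] //; congr pair.
rewrite map_iota_ord; apply: eq_map => i; rewrite !nth_map_ord /=.
by rewrite /data_of_tape /move_data; case: (act i) => a [].
Qed.

Definition sim_init (p u : bitseq) : cfg_data :=
  (val (enum_rank (TM_start U)),
   [seq ([::], map Some (nth [::] [:: p; u] j)) | j <- iota 0 k]).

Lemma sim_initE p u : sim_init p u = data_of_cfg (TM_init U p u).
Proof. by congr pair; rewrite map_iota_ord. Qed.

(** A list with at most one element, empty as long as the machine has not halted, so that results of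
    many runs can be concatenated. *)
Definition sim_out (s : nat) (p u : bitseq) : seq bitseq :=
  let d := iter s sim_step (sim_init p u) in
  if sim_next d is Some _ then [::] else
  [:: foldr (fun o r => if o is Some b then b :: r else [::]) [::]
        (nth ([::], [::]) d.2 2).2].

Lemma sim_iterE s p u :
  iter s sim_step (sim_init p u) = data_of_cfg (iter s (@TM_step U) (TM_init U p u)).
Proof. by elim: s => [|s IH]; [exact: sim_initE | rewrite !iterS IH sim_stepE]. Qed.

Lemma mem_sim_out s p u x : (x \in sim_out s p u) <->
  let c := iter s (@TM_step U) (TM_init U p u) in
  TM_halted c /\ tape_output (cfg_tapes c (inord 2)) = x.
Proof.
rewrite /sim_out sim_iterE; set c := iter _ _ _ => /=.
rewrite sim_nextE /table_value /TM_halted /TM_next.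
case: (TM_trans _ _) => [[q act]|]; first by split=> // -[].
rewrite inE; set y := foldr _ _ _.
have -> : y = tape_output (cfg_tapes c (inord 2)).
  have := nth_map_ord ([::], [::]) (fun i => data_of_tape (cfg_tapes c i)) (inord 2).
  rewrite inordK // /y => ->; rewrite /tape_output /=.
  by elim: (right_part _) => //= -[b|] r //= ->.
by split=> [/eqP ->|[_ ->]].
Qed.

Lemma computes_sim p u x : computes U p u x <-> exists s, x \in sim_out s p u.
Proof. by split=> -[s hs]; exists s; apply/mem_sim_out. Qed.

(** A halted configuration is a fixed point of [TM_step]. *)
Lemma sim_out_le s s' p u x : s <= s' -> x \in sim_out s p u -> x \in sim_out s' p u.
Proof.
move=> le /mem_sim_out[h e]; apply/mem_sim_out; rewrite -(subnK le) iterD.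
set c := iter s _ _ in h e *; have -> // : iter (s' - s) (@TM_step U) c = c.
elim: (s' - s) => //= m ->; rewrite /TM_step.
by move: h; rewrite /TM_halted; case: (TM_next c).
Qed.

Lemma size_sim_out s p u : size (sim_out s p u) <= 1.
Proof. by rewrite /sim_out; case: (sim_next _). Qed.

Lemma comp_sim_next A (cA : Code A) (f : A -> cfg_data) :
  computable f -> computable (fun a => sim_next (f a)).
Proof.
move=> hf; have h : computable sim_next.
  by rewrite /sim_next /lookup /cfg_data /tape_data; comp_tac.
exact: comp_comp h hf.
Qed.

Lemma comp_sim_step : computable sim_step.
Proof.
rewrite /sim_step.
apply: (@comp_omatch cfg_data cfg_data _ _ _ _ sim_next (fun d a => (a.1, [seq
  move_data (nth (None, None) a.2 j) (nth ([::], [::]) d.2 j) | j <- iota 0 k])) id).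
- by apply: comp_sim_next; apply: comp_id.
- by rewrite /move_data /cfg_data /tape_data; comp_tac.
- exact: comp_id.
Qed.

Lemma comp_sim_out A (cA : Code A) (s : A -> nat) (p u : A -> bitseq) :
  computable s -> computable p -> computable u ->
  computable (fun a => sim_out (s a) (p a) (u a)).
Proof.
move=> hs hp hu.
have h : computable (fun x : nat * (bitseq * bitseq) => sim_out x.1 x.2.1 x.2.2).
  have hi : computable (fun x : nat * (bitseq * bitseq) =>
      iter x.1 sim_step (sim_init x.2.1 x.2.2)).
    apply: comp_iter; first by comp_tac.
      by apply: (comp_comp (f := snd) comp_sim_step); comp_tac.
    by rewrite /sim_init /cfg_data /tape_data; comp_tac.
  apply: comp_omatch; last 1 first.
  - apply: comp_cons; last exact: comp_cst.
    apply: (comp_comp (f := fun x : nat * (bitseq * bitseq) =>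
      iter x.1 sim_step (sim_init x.2.1 x.2.2)) (g := fun d : cfg_data =>
      foldr (fun o r => if o is Some b then b :: r else [::]) [::]
        (nth ([::], [::]) d.2 2).2)) hi.
    by rewrite /cfg_data /tape_data; comp_tac.
  - exact: comp_sim_next hi.
  - exact: comp_cst.
by apply: (comp_comp (f := fun a => (s a, (p a, u a))) h); comp_tac.
Qed.

(** The strings of complexity at most [b] found before stage [s], in order of discovery. With the
    stages in the outer loop, a later list extends an earlier one at its end, so positions are
    stable. *)
Definition low (s b : nat) (u : bitseq) : seq bitseq :=
  nub (flatten [seq flatten [seq sim_out s' p u | p <- strings b] | s' <- iota 0 s]).

Lemma comp_low A (cA : Code A) (s b : A -> nat) (u : A -> bitseq) :
  computable s -> computable b -> computable u -> computable (fun a => low (s a) (b a) (u a)).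
Proof.
move=> hs hb hu.
have h : computable (fun x : nat * (nat * bitseq) => low x.1 x.2.1 x.2.2).
  rewrite /low; apply: comp_nub; apply: comp_flatten; apply: comp_map; last by comp_tac.
  apply: comp_flatten; apply: comp_map; last by comp_tac.
  by apply: comp_sim_out; comp_tac.
by apply: (comp_comp (f := fun a => (s a, (b a, u a))) h); comp_tac.
Qed.

Lemma mem_nub (T : eqType) (s : seq T) : nub s =i s.
Proof.
move=> x; rewrite -[s]revK /nub foldl_rev; elim: (rev s) => //= y r IH.
rewrite rev_cons mem_rcons inE -IH; set l := foldr _ _ _.
case: ifP => [yl|_]; last by rewrite mem_rcons inE.
by case: eqP => [->|].
Qed.

Lemma nub_uniq (T : eqType) (s : seq T) : uniq (nub s).
Proof.
rewrite -[s]revK /nub foldl_rev; elim: (rev s) => //= y r IH.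
by case: ifP => // /negbT ny; rewrite rcons_uniq ny.
Qed.

Lemma nub_cat_prefix (T : eqType) (s t : seq T) : exists r, nub (s ++ t) = nub s ++ r.
Proof.
rewrite /nub foldl_cat; elim: t (foldl _ _ s) => [|y t IH] l; first by exists [::]; rewrite cats0.
rewrite /=; case: ifP => _; first exact: IH.
by have [r ->] := IH (rcons l y); exists (y :: r); rewrite cat_rcons.
Qed.

Lemma low_prefix s s' b u : s <= s' -> exists r, low s' b u = low s b u ++ r.
Proof.
move=> le; rewrite /low -(subnKC le) iotaD map_cat flatten_cat; exact: nub_cat_prefix.
Qed.

Lemma low_le s s' b u : s <= s' -> {subset low s b u <= low s' b u}.
Proof. by move=> /low_prefix -/(_ b u)[r ->] x hx; rewrite mem_cat hx. Qed.

Lemma low_uniq s b u : uniq (low s b u). Proof. exact: nub_uniq. Qed.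

(** All outputs found earlier persist at stage [s], and there each program contributes at most
    one. *)
Lemma size_low s b u : size (low s b u) <= 2 ^ b.+1.
Proof.
apply: leq_trans (ltnW (size_strings b)).
apply: leq_trans (_ : size (flatten [seq sim_out s p u | p <- strings b]) <= _).
  apply: uniq_leq_size; first exact: low_uniq.
  move=> x; rewrite mem_nub => /flattenP[l /mapP[s' hs' ->] /flattenP[l' /mapP[p hp ->] hx]].
  apply/flattenP; exists (sim_out s p u); first exact: map_f.
  by apply: sim_out_le hx; move: hs'; rewrite mem_iota; lia.
elim: (strings b) => //= p l IH; rewrite size_cat -add1n.
exact: leq_add (size_sim_out _ _ _) IH.
Qed.

Lemma low_computes p b u x : size p <= b -> computes U p u x -> exists s, x \in low s b u.
Proof.
(* The stages range below the first argument of [low], hence the successor. *)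
move=> hp /computes_sim[s hs]; exists s.+1; rewrite mem_nub; apply/flattenP.
exists (flatten [seq sim_out s p u | p <- strings b]).
  by apply/mapP; exists s => //; rewrite mem_iota; lia.
by apply/flattenP; exists (sim_out s p u) => //; apply/mapP; exists p; rewrite ?mem_strings.
Qed.
End Simulation.

(** * Complexity bounds from enumerations *)

Definition param_cost (zs : seq nat) : nat := \sum_(z <- zs) (trunc_log 2 z).+1.

Section Complexity.
Variable U : TM.
Hypothesis Uuniv : universal U.

(** Universality applied to the machine compiled from [f]; the constant depends on [f] alone. *)
Lemma KC_fn (f : fn) : exists c, forall p u x,
  ev f (Node (tree_of_bits p) (tree_of_bits u)) (tree_of_bits x) -> KC U x u <= size p + c.
Proof.
have [c hc] := Uuniv (TM_of_fn f); exists c => p u x /ev_computes h.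
have [q hq /(_ u x)[_ /(_ h) hU]] := hc p.
apply: leq_trans hq; rewrite /KC; case: pselect => // ex.
by case: ex_minnP => m _; apply; apply/asboolP; exists q.
Qed.

Lemma KC_le_size : exists c, forall x u, KC U x u <= size x + c.
Proof.
have [c hc] := KC_fn FFst; exists c => x u; apply: hc.
exact: (ev_fst (Node (tree_of_bits x) (tree_of_bits u))).
Qed.

(** The machine that returns its program provides some program for every string, so [KC] never takes
    its default value. *)
Lemma KC_program x u : exists2 p, size p = KC U x u & computes U p u x.
Proof.
have ex : exists n, `[< exists2 p, size p = n & computes U p u x >].
  have [c hc] := Uuniv (TM_of_fn FFst); have [q hq hU] := hc x.
  exists (size q); apply/asboolP; exists q => //; apply/hU; apply: ev_computes.
  exact: (ev_fst (Node (tree_of_bits x) (tree_of_bits u))).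
rewrite /KC; case: pselect => // ex'; case: ex_minnP => m /asboolP[p <- h] _.
by exists p.
Qed.

Lemma low_KC x u b : KC U x u <= b -> exists s, x \in low U s b u.
Proof. by have [p <- h] := KC_program x u => hb; apply: low_computes hb h. Qed.

(* The program consists of the parameters [zs] in self-delimiting form and of
   the position of [y] among the strings enumerated by [f]. *)
Lemma KC_enum (f : (seq nat * bitseq) * nat -> seq bitseq) : computable f ->
  exists c, forall zs u k,
    (forall s, exists2 G : seq bitseq, size G <= 2 ^ k &
       forall s', s' < s -> {subset f (zs, u, s') <= G}) ->
    forall s y, y \in f (zs, u, s) -> KC U y u <= k + c * param_cost zs + c.
Proof.
move=> hf.
(* Only the parameters are delimited; the position fills the rest of the program at no extra
   cost. *)
pose params (p : bitseq) := ([seq bits_val w | w <- decode (undelim p).1], bits_val (undelim p).2).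
pose found (x : (bitseq * bitseq) * nat) :=
  nub (flatten [seq f ((params x.1.1).1, x.1.2, s) | s <- iota 0 x.2]).
have hfound : computable found.
  rewrite /found; apply: comp_nub; apply: comp_flatten; apply: comp_map; last by comp_tac.
  apply: (comp_comp (f := fun x : (bitseq * bitseq) * nat * nat =>
    ((params x.1.1.1).1, x.1.1.2, x.2)) hf).
  by rewrite /params; comp_tac.
have hc : computable (fun x : (bitseq * bitseq) * nat => size (found x) <= (params x.1.1).2).
  by apply: comp_leq; [apply: comp_size | rewrite /params; comp_tac].
have hs : computable (fun x : (bitseq * bitseq) * nat => (x.1, x.2.+1)) by comp_tac.
have [pw hw] := comp_while hc hs.
have [po ho] : computable (fun x : (bitseq * bitseq) * nat =>
    nth [::] (found x) (params x.1.1).2).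
  by apply: comp_nth => //; rewrite /params; comp_tac.
have paramsE ws w : params (delimited (encode ws) ++ w) = ([seq bits_val v | v <- ws], bits_val w).
  by rewrite /params undelimK /= encodeK.
have foundE p u n :
    found ((p, u), n) = nub (flatten [seq f ((params p).1, u, s) | s <- iota 0 n]) by [].
clearbody found params.
have [c hcK] := KC_fn (FComp po (FComp pw (FPair FId FLeaf))).
exists (c + 6) => zs u k hk s y hy.
pose found' n := nub (flatten [seq f (zs, u, s) | s <- iota 0 n]).
have yS : y \in found' s.+1.
  rewrite mem_nub; apply/flattenP; exists (f (zs, u, s)) => //.
  by apply/mapP; exists s => //; rewrite mem_iota; lia.
pose idx := index y (found' s.+1).
(* All strings listed before a given stage lie in a common list of size at most 2^k, so [k] bits
   suffice for the position. *)
have hidx : idx < 2 ^ k.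
  have [G hG hsub] := hk s.+1; apply: leq_trans hG.
  apply: leq_trans (_ : size (found' s.+1) <= _); first by rewrite index_mem.
  apply: uniq_leq_size; first exact: nub_uniq.
  move=> x; rewrite mem_nub => /flattenP[l /mapP[s' hs' ->]]; apply: hsub.
  by move: hs'; rewrite mem_iota; lia.
have [w ww ew] := bits_val_surj hidx.
(* A numeral of L >= 1 bits costs 2L + 1 <= 3L when delimited. Delimiting the whole list doubles
   this, which explains the 6 in the constant. *)
have [ws es ez] : exists2 ws, [seq bits_val w | w <- ws] = zs &
    size (encode ws) <= 3 * param_cost zs.
  rewrite /param_cost; elim: zs {hk hy found' yS idx hidx ew} => [|z zs [ws <- IH]].
    by exists [::].
  have zlt : z < 2 ^ (trunc_log 2 z).+1 by apply: trunc_log_ltn.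
  have [v hv ev] := bits_val_surj zlt.
  exists (v :: ws); first by rewrite /= ev.
  rewrite big_cons /encode /= size_cat -/(encode ws).
  have -> : size (delimited v) = (size v).*2.+1 by elim: v {hv ev} => //= b v ->.
  by rewrite hv; move: IH; lia.
pose p := delimited (encode ws) ++ w.
have ep : params p = (zs, idx) by rewrite paramsE es ew.
have efound n : found ((p, u), n) = found' n by rewrite foundE ep.
have ex : exists n, idx < size (found' n) by exists s.+1; rewrite index_mem.
have h : KC U y u <= size p + c.
  apply: hcK.
  (* The search stops at the first stage [n] whose list reaches position [idx]. Later stages only
     append, so the entry found there is already [y]. *)
  case: (ex_minnP ex) => n hn nmin.
  have it m : iter m (fun x : (bitseq * bitseq) * nat => (x.1, x.2.+1)) ((p, u), 0) = ((p, u), m).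
    by elim: m => //= m ->.
  have := hw ((p, u), 0) n; rewrite it /= efound ep /= -ltnNge hn => /(_ _ isT) hw'.
  have ey : y = nth [::] (found ((p, u), n)) (params p).2.
    rewrite efound ep /=; have nS : n <= s.+1 by apply: nmin; rewrite index_mem.
    have [r er] : exists r, found' s.+1 = found' n ++ r.
      by rewrite /found' -(subnKC nS) iotaD map_cat flatten_cat; exact: nub_cat_prefix.
    by rewrite -[LHS](nth_index [::] yS) -/idx er nth_cat hn.
  apply: ev_comp; last by rewrite [in tree_of_bits y]ey; apply: (ho ((p, u), n)).
  apply: ev_comp; last first.
    apply: hw' => m mn; rewrite it /= efound ep /= leqNgt; apply/negP => /nmin.
    by rewrite leqNgt mn.
  by apply: ev_pair (ev_id _) (ev_leaf _).
apply: leq_trans h _; rewrite size_cat ww.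
have -> : size (delimited (encode ws)) = (size (encode ws)).*2.+1.
  by elim: (encode ws) => //= b v ->.
by move: ez; move: (param_cost zs) => Z; nia.
Qed.
End Complexity.

(** * Symmetry of information *)

Lemma bits_val_bin_succ s : bits_val (bin_succ s) = (bits_val s).+1.
Proof. by elim: s => //= -[] s IH //=; rewrite IH; lia. Qed.

Lemma binary_inj : injective binary.
Proof.
apply: (can_inj (g := bits_val)) => n; rewrite /binary.
by elim: n => //= n IH; rewrite bits_val_bin_succ IH.
Qed.

(** [K] is the integer part of the logarithm of the maximum of [g]. The maximum is obtained
    classically: it need not be computable, as its logarithm is supplied to programs as a
    parameter. *)
Lemma bounded_log (g : nat -> nat) B s0 : 0 < g s0 -> (forall s, g s <= B) ->
  exists K, (exists s, 2 ^ K <= g s) /\ forall s, g s < 2 ^ K.+1.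
Proof.
move=> g0 gB; pose Q v := `[< exists s, g s = v >].
have ex : exists v, Q v by exists (g s0); apply/asboolP; exists s0.
have bd v : Q v -> v <= B by move=> /asboolP[s <-].
case: (ex_maxnP ex bd) => v /asboolP[s es] vmax.
have v0 : 0 < v by apply: leq_trans g0 _; apply: vmax; apply/asboolP; exists s0.
exists (trunc_log 2 v); split; first by exists s; rewrite es; apply: trunc_logP.
move=> s'; apply: leq_ltn_trans (trunc_log_ltn _ _) => //.
by apply: vmax; apply/asboolP; exists s'.
Qed.

(** Each [e] is counted for at most one [x], namely [h e]. *)
Lemma sum_count_uniq (T S : eqType) (h : T -> S) (X : seq S) (E : seq T) :
  uniq X -> \sum_(x <- X) count (fun e => h e == x) E <= size E.
Proof.
move=> uX; elim: E => [|e E IH]; first by rewrite big1.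
rewrite /= big_split /= -add1n; apply: leq_add => //.
have -> : \sum_(x <- X) (h e == x) = count_mem (h e) X.
  by elim: {uX IH} X => [|x X IHX]; rewrite ?big_nil // big_cons IHX /= eq_sym.
by rewrite count_uniq_mem // leq_b1.
Qed.

Section Enumerations.
Variable U : TM.

Definition rect_cells (u : bitseq) : seq (seq (seq bitseq)) :=
  [seq [seq decode c | c <- decode q] | q <- decode (nth [::] (decode u) 1)].

Definition fiber (s b : nat) (u : bitseq) (i : nat) (q : seq (seq bitseq)) : seq bitseq :=
  [seq x <- low U s b u | has (fun cell => nth [::] cell i == x) q].

(** The pairs (r, x') of the symmetry argument found by stage [s]. Truncating the fibers bounds the
    number of edges even if some rectangles have larger fibers. *)
Definition edges (s m A i b : nat) (u : bitseq) : seq (bitseq * bitseq) :=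
  flatten [seq [seq (binary j, x)
               | x <- take (2 ^ A.+1) (fiber s b u i (nth [::] (rect_cells u) j))]
          | j <- iota 0 (size (rect_cells u)) & binary j \in low U s m u].

Lemma comp_rect_cells A (cA : Code A) (u : A -> bitseq) :
  computable u -> computable (fun a => rect_cells (u a)).
Proof.
move=> hu; have h : computable rect_cells by rewrite /rect_cells; comp_tac.
exact: comp_comp h hu.
Qed.

Lemma comp_fiber A (cA : Code A) (s b : A -> nat) (u : A -> bitseq) (i : A -> nat)
    (q : A -> seq (seq bitseq)) :
  computable s -> computable b -> computable u -> computable i -> computable q ->
  computable (fun a => fiber (s a) (b a) (u a) (i a) (q a)).
Proof.
move=> hs hb hu hi hq.
have h : computable (fun x : nat * nat * bitseq * nat * seq (seq bitseq) =>
    fiber x.1.1.1.1 x.1.1.1.2 x.1.1.2 x.1.2 x.2).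
  by apply: comp_filter; [|apply: comp_low]; comp_tac.
by apply: (comp_comp (f := fun a => (s a, b a, u a, i a, q a)) h); comp_tac.
Qed.

Lemma comp_edges B (cB : Code B) (s m A i b : B -> nat) (u : B -> bitseq) :
  computable s -> computable m -> computable A -> computable i -> computable b -> computable u ->
  computable (fun a => edges (s a) (m a) (A a) (i a) (b a) (u a)).
Proof.
move=> hs hm hA hi hb hu.
have h : computable (fun x : nat * nat * nat * nat * nat * bitseq =>
    edges x.1.1.1.1.1 x.1.1.1.1.2 x.1.1.1.2 x.1.1.2 x.1.2 x.2).
  rewrite /edges; apply: comp_flatten; apply: comp_map.
    apply: comp_map; first by comp_tac.
    apply: comp_take; last by comp_tac.
    by apply: comp_fiber; comp_tac; apply: comp_rect_cells; comp_tac.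
  apply: comp_filter; first by apply: comp_mem; [|apply: comp_low]; comp_tac.
  by apply: comp_iota; apply: comp_size; apply: comp_rect_cells; comp_tac.
by apply: (comp_comp (f := fun a => (s a, m a, A a, i a, b a, u a)) h); comp_tac.
Qed.

Lemma fiber_prefix s s' b u i q : s <= s' -> exists r, fiber s' b u i q = fiber s b u i q ++ r.
Proof.
by move=> /(low_prefix U b u)[r e]; rewrite /fiber e filter_cat; eexists.
Qed.

Lemma size_fiber s b u i q : size (fiber s b u i q) <= 2 ^ b.+1.
Proof. by rewrite size_filter; apply: leq_trans (count_size _ _) (size_low _ _ _ _). Qed.

Lemma mem_edges s m A i b u y x : ((y, x) \in edges s m A i b u) <->
  exists j, [/\ j < size (rect_cells u), y = binary j, y \in low U s m u &
    x \in take (2 ^ A.+1) (fiber s b u i (nth [::] (rect_cells u) j))].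
Proof.
split=> [/flattenP[l /mapP[j hj ->] /mapP[x' hx' [-> ->]]]|[j [hj -> hy hx]]].
  by move: hj; rewrite mem_filter mem_iota add0n => /andP[hl hj]; exists j.
apply/flattenP; eexists; first by apply/mapP; exists j; rewrite // mem_filter hy mem_iota.
by apply/mapP; exists x.
Qed.

(** Truncation is compatible with later stages because fibers grow only at their end. *)
Lemma edges_le s s' m A i b u : s <= s' -> {subset edges s m A i b u <= edges s' m A i b u}.
Proof.
move=> le [y x] /mem_edges[j [hj ey hy hx]]; apply/mem_edges; exists j; split=> //.
  exact: low_le hy.
have [r ->] := fiber_prefix b u i (nth [::] (rect_cells u) j) le.
rewrite take_cat; case: ltnP => // _; rewrite mem_cat.
by rewrite (mem_take hx).
Qed.

Lemma size_edges s m A i b u : size (edges s m A i b u) <= 2 ^ (m.+1 + A.+1).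
Proof.
rewrite /edges; set J := [seq j <- _ | _].
apply: leq_trans (_ : size J * 2 ^ A.+1 <= _).
  elim: J => //= j J IH; rewrite size_cat mulSn size_map; apply: leq_add => //.
  by rewrite size_take_min geq_minl.
rewrite expnD leq_mul2r -(size_map binary); apply/orP; right.
apply: leq_trans (size_low U s m u); apply: uniq_leq_size.
  by rewrite (map_inj_uniq binary_inj) filter_uniq ?iota_uniq.
by move=> y /mapP[j hj ->]; move: hj; rewrite mem_filter => /andP[].
Qed.

Definition edge_degree (E : seq (bitseq * bitseq)) (x : bitseq) : nat :=
  size (nub [seq e.1 | e <- E & e.2 == x]).

Lemma edge_degree_le E E' x : {subset E <= E'} -> edge_degree E x <= edge_degree E' x.
Proof.
move=> sub; apply: uniq_leq_size; first exact: nub_uniq.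
move=> y; rewrite !mem_nub => /mapP[e he ->]; apply: map_f.
by move: he; rewrite !mem_filter => /andP[-> /sub].
Qed.

(** Here the condition encodes the pair of a string and the protocol; the parameters are [m], [A],
    [i] and [b]. *)
Definition list_neighbours (z : (seq nat * bitseq) * nat) : seq bitseq :=
  [seq e.1 | e <- edges z.2 (nth 0 z.1.1 0) (nth 0 z.1.1 1) (nth 0 z.1.1 2) (nth 0 z.1.1 3)
                    (nth [::] (decode z.1.2) 1)
           & e.2 == nth [::] (decode z.1.2) 0].

Lemma comp_list_neighbours : computable list_neighbours.
Proof.
rewrite /list_neighbours; apply: comp_map; first by comp_tac.
apply: comp_filter; first by comp_tac.
by apply: comp_edges; comp_tac.
Qed.

(** Here the condition is the protocol alone, and the fifth parameter is the logarithm [K] of the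
    required degree. *)
Definition list_rich (z : (seq nat * bitseq) * nat) : seq bitseq :=
  let E := edges z.2 (nth 0 z.1.1 0) (nth 0 z.1.1 1) (nth 0 z.1.1 2) (nth 0 z.1.1 3) z.1.2 in
  [seq e.2 | e <- E & 2 ^ nth 0 z.1.1 4 <= edge_degree E e.2].

Lemma comp_list_rich : computable list_rich.
Proof.
have h : computable (fun y : seq (bitseq * bitseq) * nat =>
    [seq e.2 | e <- y.1 & 2 ^ y.2 <= edge_degree y.1 e.2]).
  apply: comp_map; first by comp_tac.
  by apply: comp_filter; rewrite /edge_degree; comp_tac.
apply: (comp_comp (f := fun z : (seq nat * bitseq) * nat =>
  (edges z.2 (nth 0 z.1.1 0) (nth 0 z.1.1 1) (nth 0 z.1.1 2) (nth 0 z.1.1 3) z.1.2,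
   nth 0 z.1.1 4)) h).
apply: comp_pair; last by comp_tac.
by apply: comp_edges; comp_tac.
Qed.

Hypothesis Uuniv : universal U.

(** With 2^K the order of magnitude of the final degree of [x], the two enumerations give K + 1 and
    m + A + 2 - K; the sum no longer contains K. The entry [m.+1] of the parameter list stands for a
    bound on K. *)
Lemma edges_symmetry : exists c, forall u x j m b A i,
  j < size (rect_cells u) -> KC U (binary j) u <= m -> KC U x u <= b ->
  has (fun cell => nth [::] cell i == x) (nth [::] (rect_cells u) j) ->
  (forall s, size (fiber s b u i (nth [::] (rect_cells u) j)) <= 2 ^ A.+1) ->
  KC U (binary j) (encode [:: x; u]) + KC U x u <=
    m + A + c * param_cost [:: m; A; i; b; m.+1] + c.
Proof.
have [c1 hc1] := KC_enum Uuniv comp_list_neighbours.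
have [c2 hc2] := KC_enum Uuniv comp_list_rich.
exists (c1 + c2 + 3) => u x j m b A i hj hm hb hx hA.
set y := binary j.
have [s1 hs1] := low_KC Uuniv hm; have [s2 hs2] := low_KC Uuniv hb.
have yx : (y, x) \in edges (maxn s1 s2) m A i b u.
  apply/mem_edges; exists j; split=> //; first exact: low_le (leq_maxl _ _) _ hs1.
  (* By hypothesis the fiber of this rectangle never exceeds the truncation length, so [x] is not
     cut off. *)
  rewrite take_oversize ?hA // mem_filter hx.
  exact: low_le (leq_maxr _ _) _ hs2.
have dB s : edge_degree (edges s m A i b u) x <= 2 ^ m.+1.
  apply: leq_trans (size_low U s m u); apply: uniq_leq_size; first exact: nub_uniq.
  move=> y'; rewrite mem_nub => /mapP[[y1 x1] he ->].
  by move: he; rewrite mem_filter => /andP[_ /mem_edges[j' [_ _ ]]].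
have mem_deg s y' x' : (y', x') \in edges s m A i b u ->
    y' \in nub [seq e.1 | e <- edges s m A i b u & e.2 == x'].
  by move=> h; rewrite mem_nub; apply/mapP; exists (y', x'); rewrite // mem_filter eqxx.
have d0 : 0 < edge_degree (edges (maxn s1 s2) m A i b u) x.
  by rewrite /edge_degree; have := mem_deg _ _ _ yx; case: (nub _).
have [K [[s3 hs3] hK]] := bounded_log (g := fun s => edge_degree (edges s m A i b u) x) d0 dB.
have Km : K <= m.+1.
  by have := leq_trans hs3 (dB s3); rewrite leq_exp2l.
have ha : KC U y (encode [:: x; u]) <= K.+1 + c1 * param_cost [:: m; A; i; b] + c1.
  apply: (hc1 _ _ _ _ (maxn s1 s2)) => [s|].
    exists (nub (list_neighbours ([:: m; A; i; b], encode [:: x; u], s))).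
      by rewrite /list_neighbours /= encodeK /=; exact: ltnW (hK s).
    move=> s' /ltnW le y'; rewrite mem_nub /list_neighbours /= encodeK /=.
    move=> /mapP[e he ->]; apply: map_f; move: he; rewrite !mem_filter => /andP[-> he] /=.
    exact: edges_le he.
  rewrite /list_neighbours /= encodeK /=; apply/mapP; exists (y, x) => //.
  by rewrite mem_filter eqxx.
have richE s x' : (x' \in list_rich ([:: m; A; i; b; K], u, s)) =
    (2 ^ K <= edge_degree (edges s m A i b u) x').
  apply/mapP/idP => [[e]|h]; first by rewrite mem_filter => /andP[h _] ->.
  have : 0 < edge_degree (edges s m A i b u) x' by apply: leq_trans h; rewrite expn_gt0.
  rewrite /edge_degree; case en : (nub _) => [//|y' r] _.
  have : y' \in nub [seq e.1 | e <- edges s m A i b u & e.2 == x'] by rewrite en mem_head.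
  rewrite mem_nub => /mapP[e]; rewrite mem_filter => /andP[/eqP e2 he] _.
  by exists e => //; rewrite mem_filter /= e2 h.
have KmA : K <= m.+1 + A.+1 by lia.
have hb' : KC U x u <= m.+1 + A.+1 - K + c2 * param_cost [:: m; A; i; b; K] + c2.
  apply: (hc2 _ _ _ _ s3) => [s|]; last by rewrite richE.
  exists (nub (list_rich ([:: m; A; i; b; K], u, s))); last first.
    move=> s' /ltnW le x'; rewrite mem_nub !richE => h; apply: leq_trans h _.
    by apply: edge_degree_le; apply: edges_le.
  (* Double counting: each rich string has at least 2^K edges and each edge ends in one string, so
     at most 2^(m+A+2-K) strings are rich. *)
  set X := nub _; rewrite -(leq_pmul2r (expn_gt0 2 K : _)) -expnD subnK //.
  apply: leq_trans (size_edges s m A i b u).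
  apply: leq_trans (sum_count_uniq snd (edges s m A i b u) (nub_uniq _ : uniq X)).
  have -> : size X * 2 ^ K = \sum_(x' <- X) 2 ^ K.
    by rewrite big_const_seq count_predT iter_addn_0 mulnC.
  rewrite !big_seq; apply: leq_sum => x'; rewrite mem_nub richE => h; apply: leq_trans h _.
  rewrite /edge_degree -size_filter -(size_map fst).
  by apply: uniq_leq_size; [exact: nub_uniq | move=> z; rewrite mem_nub].
have z1 : param_cost [:: m; A; i; b] <= param_cost [:: m; A; i; b; m.+1].
  by rewrite /param_cost !big_cons; lia.
have z2 : param_cost [:: m; A; i; b; K] <= param_cost [:: m; A; i; b; m.+1].
  by rewrite /param_cost !big_cons; have := leq_trunc_log 2 Km; lia.
move: ha hb' z1 z2; move: (param_cost _) (param_cost _) (param_cost _) => Z1 Z2 Z3; nia.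
Qed.
End Enumerations.

(** * Counting rectangles *)

Section Protocol.
Variables (l : nat) (ns : 'I_l -> nat).

(** Double counting of the pairs of a member of [G] and one of its cells inside the product of the
    [L i]. *)
Lemma rectangle_count (G : seq {set cell ns})
    (L : forall i : 'I_l, {set (ns i).-tuple bool}) (a : 'I_l -> nat) (r : nat) :
  (forall Q, Q \in G -> exists2 S : (forall i : 'I_l, {set (ns i).-tuple bool}),
     Q = setXn S & forall i, 2 ^ a i <= #|S i :&: L i|) ->
  (forall Q x, Q \in G -> x \in Q -> count (fun Q' : {set cell ns} => x \in Q') G <= 2 ^ r) ->
  size G * 2 ^ (\sum_i a i) <= (\prod_i #|L i|) * 2 ^ r.
Proof.
move=> hG hr.
have -> : size G * 2 ^ (\sum_i a i) = \sum_(Q <- G) 2 ^ (\sum_i a i).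
  by rewrite big_const_seq count_predT iter_addn_0 mulnC.
apply: leq_trans (_ : \sum_(Q <- G) \sum_(x in setXn L) (x \in Q) <= _).
  rewrite [leqLHS]big_seq [leqRHS]big_seq; apply: leq_sum => Q /hG[S eQ hS].
  have -> : \sum_(x in setXn L) (x \in Q) = #|setXn (fun i => S i :&: L i)|.
    rewrite -sum1_card big_mkcond [RHS]big_mkcond /=; apply: eq_bigr => x _.
    have -> : (x \in setXn (fun i => S i :&: L i)) = (x \in Q) && (x \in setXn L).
      rewrite eQ; apply/setXnP/andP => [h|[/setXnP h1 /setXnP h2] i]; last by rewrite inE h1 h2.
      by split; apply/setXnP => i; have := h i; rewrite inE => /andP[].
    by rewrite andbC; case: (x \in setXn L); case: (x \in Q).
  rewrite cardsXn expn_sum; apply: leq_prod => i _; exact: hS.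
rewrite exchange_big /= -cardsXn -sum_nat_const; apply: leq_sum => x _.
have -> : \sum_(Q <- G) (x \in Q) = count (fun Q' : {set cell ns} => x \in Q') G.
  by elim: (G) => [|Q G' IH]; rewrite ?big_nil // big_cons IH.
(* The multiplicity bound concerns cells covered by [G]; the others count zero. *)
case: (boolP (has (fun Q' : {set cell ns} => x \in Q') G)) => [/hasP[Q QG xQ]|].
  exact: hr QG xQ.
by rewrite has_count -leqNgt leqn0 => /eqP ->.
Qed.

Definition cell_list (x : cell ns) : seq bitseq := [seq (x i : bitseq) | i <- enum 'I_l].

Lemma nth_cell_list x (i : 'I_l) : nth [::] (cell_list x) i = x i.
Proof. by rewrite (nth_map i) ?size_enum_ord // nth_ord_enum. Qed.

Lemma cell_list_inj : injective cell_list.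
Proof.
move=> x y e; apply/ffunP => i; apply: val_inj.
by have := congr1 (fun s => nth [::] s i) e; rewrite !nth_cell_list.
Qed.

Variable P : protocol ns.

Lemma rect_cells_protocol :
  rect_cells (protocol_string P) =
    [seq [seq cell_list x | x <- enum Q] | Q : {set cell ns} <- rects P].
Proof.
rewrite /rect_cells /protocol_string encodeK /= encodeK -map_comp.
apply: eq_map => Q /=; rewrite encodeK -map_comp; apply: eq_map => x /=.
by rewrite /cell_string encodeK.
Qed.

Lemma nth_rect_cells (Q : {set cell ns}) : Q \in rects P ->
  nth [::] (rect_cells (protocol_string P)) (index Q (rects P)) = [seq cell_list x | x <- enum Q].
Proof. by move=> hQ; rewrite rect_cells_protocol (nth_map set0) ?index_mem // nth_index. Qed.

(** Thickness is read off the decoded protocol, hence can be tested by a program that is given the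
    protocol. *)
Lemma cell_thickness_list (x : cell ns) :
  size [seq q <- rect_cells (protocol_string P) | cell_list x \in q] = cell_thickness P x.
Proof.
rewrite rect_cells_protocol size_filter count_map /cell_thickness.
have -> : [set Q in rects P | x \in Q] = [set Q in [seq Q : {set cell ns} <- rects P | x \in Q]].
  by apply/setP => Q; rewrite !inE mem_filter andbC.
rewrite cardsE (card_uniqP _) ?filter_uniq ?rects_uniq // size_filter.
by apply: eq_count => Q /=; rewrite (mem_map cell_list_inj) mem_enum.
Qed.
End Protocol.

Section Thickness.
Variables (U : TM) (l : nat).

(** Membership in the set G at stage [s]. The parameters are r, then the b_i, then the A_i, hence
    the shifted indices. The thickness test is independent of [s], and the fiber test can only turn
    from false to true. *)
Definition rect_ok (zs : seq nat) (u : bitseq) (s : nat) (q : seq (seq bitseq)) : bool :=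
  all (fun cl => size [seq q' <- rect_cells u | cl \in q'] <= 2 ^ nth 0 zs 0) q &&
  all (fun i => 2 ^ nth 0 zs (l + i).+1 <= size (fiber U s (nth 0 zs i.+1) u i q)) (iota 0 l).

Definition list_ok (z : (seq nat * bitseq) * nat) : seq bitseq :=
  [seq binary j | j <- iota 0 (size (rect_cells z.1.2))
                & rect_ok z.1.1 z.1.2 z.2 (nth [::] (rect_cells z.1.2) j)].

Lemma comp_list_ok : computable list_ok.
Proof.
rewrite /list_ok /rect_ok; apply: comp_map; first by comp_tac.
apply: comp_filter; last by apply: comp_iota; apply: comp_size; apply: comp_rect_cells; comp_tac.
apply: comp_and; apply: comp_all.
- apply: comp_leq; last by comp_tac.
  apply: comp_size; apply: comp_filter; first by comp_tac.
  by apply: comp_rect_cells; comp_tac.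
- by apply: comp_nth; [apply: comp_rect_cells|]; comp_tac.
- apply: comp_leq; first by comp_tac.
  apply: comp_size; apply: comp_fiber; comp_tac.
  by apply: comp_rect_cells; comp_tac.
- by comp_tac.
Qed.

Hypothesis Uuniv : universal U.

(** [Q] is listed in an enumeration whose length at every stage is at most 2 to the power sum (b_i +
    1) + r - sum a_i, by [rectangle_count]. *)
Lemma KC_rectangle : exists c, forall (ns : 'I_l -> nat) (P : protocol ns) (Q : {set cell ns})
    (b a : 'I_l -> nat) (r : nat),
  Q \in rects P -> thickness P Q <= 2 ^ r ->
  (forall i, exists s, 2 ^ a i <= size (fiber U s (b i) (protocol_string P) i
     (nth [::] (rect_cells (protocol_string P)) (index Q (rects P))))) ->
  KC U (rect_string P Q) (protocol_string P) + \sum_i a i <=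
    \sum_i (b i).+1 + r +
    c * param_cost (r :: [seq b i | i <- enum 'I_l] ++ [seq a i | i <- enum 'I_l]) + c.
Proof.
have [c hc] := KC_enum Uuniv comp_list_ok; exists c => ns P Q b a r hQ hr ha.
set u := protocol_string P in ha *; set zs := r :: _.
have zb (i : 'I_l) : nth 0 zs i.+1 = b i.
  by rewrite /= nth_cat size_map size_enum_ord ltn_ord (nth_map i) ?size_enum_ord // nth_ord_enum.
have za (i : 'I_l) : nth 0 zs (l + i).+1 = a i.
  rewrite /= nth_cat size_map size_enum_ord ltnNge leq_addr /= addKn.
  by rewrite (nth_map i) ?size_enum_ord // nth_ord_enum.
have okE s q : rect_ok zs u s q =
    all (fun cl => size [seq q' <- rect_cells u | cl \in q'] <= 2 ^ r) q &&
    [forall i : 'I_l, 2 ^ a i <= size (fiber U s (b i) u i q)].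
  congr andb; apply/allP/forallP => h i.
    by have := h (val i); rewrite mem_iota add0n leq0n ltn_ord za zb => /(_ isT).
  rewrite mem_iota add0n => /andP[_ li].
  by have := h (Ordinal li); rewrite -za -zb.
have ok_le s s' q : s <= s' -> rect_ok zs u s q -> rect_ok zs u s' q.
  move=> le; rewrite !okE => /andP[-> /forallP h]; apply/forallP => i.
  have [t ->] := fiber_prefix U (b i) u i q le.
  by rewrite size_cat; apply: leq_trans (h i) (leq_addr _ _).
have [s hs] : exists s, rect_ok zs u s (nth [::] (rect_cells u) (index Q (rects P))).
  (* Each coordinate has its own stage; their maximum serves all of them, since fibers only grow. *)
  have [s hs] := choice ha; exists (\max_i s i); rewrite okE; apply/andP; split.
    rewrite nth_rect_cells //; apply/allP => cl /mapP[x]; rewrite mem_enum => xQ ->.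
    rewrite cell_thickness_list; apply: leq_trans hr.
    exact: (leq_bigmax_cond (F := cell_thickness P)).
  apply/forallP => i; apply: leq_trans (hs i) _.
  set q := nth _ _ _; have [t ->] := fiber_prefix U (b i) u i q (leq_bigmax i : s i <= \max_i s i).
  by rewrite size_cat leq_addr.
have count_ok s' : size (list_ok (zs, u, s')) * 2 ^ (\sum_i a i) <= 2 ^ (\sum_i (b i).+1 + r).
  pose cl (Q' : {set cell ns}) := [seq cell_list x | x <- enum Q'].
  pose G := [seq Q' : {set cell ns} <- rects P | rect_ok zs u s' (cl Q')].
  have -> : size (list_ok (zs, u, s')) = size G.
    rewrite /list_ok size_map !size_filter /= -/u.
    transitivity (count (rect_ok zs u s') (rect_cells u)).
      rewrite -{3}[rect_cells u](mkseq_nth [::]) /mkseq count_map; exact: eq_count.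
    by rewrite rect_cells_protocol count_map.
  pose L i := [set w : (ns i).-tuple bool | (w : bitseq) \in low U s' (b i) u].
  apply: leq_trans (rectangle_count (L := L) (a := a) (r := r) _ _) _.
  - move=> Q'; rewrite mem_filter okE => /andP[/andP[_ /forallP h] Q'P].
    have [S eS] := rects_rectangle Q'P; exists S => // i; apply: leq_trans (h i) _.
    rewrite cardE -(size_map val); apply: uniq_leq_size;
      first by apply: filter_uniq; apply: low_uniq.
    move=> w; rewrite mem_filter => /andP[/hasP[_ /mapP[x xQ ->] /eqP <-] hw].
    rewrite nth_cell_list in hw *; apply/mapP; exists (x i) => //.
    rewrite mem_enum !inE hw andbT; move: xQ; rewrite mem_enum eS => /setXnP; apply.
  - move=> Q' x; rewrite mem_filter okE => /andP[/andP[/allP h _] Q'P] xQ.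
    have := h (cell_list x); rewrite cell_thickness_list.
    have -> : cell_list x \in cl Q' by rewrite map_f // mem_enum.
    move=> /(_ isT); apply: leq_trans.
    (* The members of [G] through [x] are among all rectangles through [x], whose number is the
       thickness. *)
    rewrite -cell_thickness_list rect_cells_protocol size_filter count_map.
    rewrite /G count_filter; apply: sub_count => Q'' /= /andP[xQ'' _].
    by rewrite map_f // mem_enum.
  - rewrite expnD leq_mul2r expn_sum; apply/orP; right; apply: leq_prod => i _.
    apply: leq_trans (size_low U s' (b i) u); rewrite cardE -(size_map val).
    apply: uniq_leq_size; first by rewrite (map_inj_uniq val_inj) enum_uniq.
    by move=> w /mapP[v]; rewrite mem_enum inE => hv ->.
have mem_ok s' : rect_ok zs u s' (nth [::] (rect_cells u) (index Q (rects P))) ->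
    rect_string P Q \in list_ok (zs, u, s').
  move=> h; apply/mapP; exists (index Q (rects P)) => //; rewrite mem_filter h mem_iota /=.
  by rewrite rect_cells_protocol size_map index_mem.
(* The list is nonempty at a suitable stage, so the natural subtraction below is exact. *)
have le_sum : \sum_i a i <= \sum_i (b i).+1 + r.
  have := count_ok s; have := mem_ok s hs; case: (list_ok _) => // y t _.
  rewrite /= mulSn => h; rewrite -(leq_exp2l (m := 2)) //; apply: leq_trans h; exact: leq_addr.
suff : KC U (rect_string P Q) u <=
    (\sum_i (b i).+1 + r - \sum_i a i) + c * param_cost zs + c by lia.
apply: (hc _ _ _ _ s); last exact: mem_ok.
move=> s'; exists (list_ok (zs, u, s')).
  by rewrite -(leq_pmul2r (expn_gt0 2 (\sum_i a i) : _)) -expnD subnK.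
move=> s'' /ltnW le y /mapP[j hj ->]; apply/mapP; exists j => //.
move: hj; rewrite !mem_filter => /andP[h ->]; rewrite andbT; exact: ok_le h.
Qed.
End Thickness.

(** * Logarithmic error terms and the final inequality *)

Lemma param_cost_le (zs : seq nat) B :
  (forall z, z \in zs -> z <= B) -> param_cost zs <= size zs * (trunc_log 2 B).+1.
Proof.
move=> h; rewrite /param_cost big_seq.
apply: leq_trans (_ : \sum_(z <- zs | z \in zs) (trunc_log 2 B).+1 <= _).
  by apply: leq_sum => z /h hz; rewrite ltnS leq_trunc_log.
by rewrite -big_seq big_const_seq count_predT iter_addn_0 mulnC.
Qed.

Lemma trunc_log2_mul n D : 0 < n -> trunc_log 2 (n * 2 ^ D) <= trunc_log 2 n + D.
Proof.
move=> n0; rewrite -ltnS -(ltn_exp2l (m := 2)) // -addSn expnD.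
apply: leq_ltn_trans (trunc_logP _ _) _; rewrite ?muln_gt0 ?n0 ?expn_gt0 //.
by rewrite ltn_mul2r expn_gt0 trunc_log_ltn.
Qed.

(** The theorem in natural numbers, with denominators cleared. The predecessor of the rounded-up
    logarithm is used as it never exceeds the real logarithm of the thickness. *)
Lemma KC_sum_le (l : nat) (U : TM) : 2 <= l -> universal U ->
  exists C : nat, forall (ns : 'I_l -> nat) (P : protocol ns) (x : cell ns),
    let t := transcript P x in
    let ts := rect_string P t in
    \sum_(i < l) KC U ts (encode [:: (x i : bitseq); protocol_string P]) <=
      l.-1 * KC U ts (protocol_string P) + (up_log 2 (thickness P t)).-1 +
      C * trunc_log 2 (max_length P x + 2).
Proof.
move=> l2 Uuniv.
have [c0 hc0] := KC_le_size Uuniv.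
have [c1 hc1] := edges_symmetry Uuniv.
have [c2 hc2] := @KC_rectangle U l Uuniv.
(* Chosen so that (l + 2)(n + c0 + 2) <= (n + 2) D <= (n + 2) 2^D. *)
pose D := (l + 2) * (c0 + 1).
(* 1 pays for passing from [r] to [r.-1], [l] for the successors of the b_i, and the rest for [l]
   uses of symmetry of information and one of the thickness bound, with 5 and 2l + 1 parameters. *)
exists (1 + l + l * (c1 * (5 * (D + 2)) + c1) + c2 * ((2 * l + 1) * (D + 2)) + c2).
move=> ns P x; cbv zeta; set t := transcript P x; set ts := rect_string P t.
set n := max_length P x; set u := protocol_string P.
set T := trunc_log 2 (n + 2); set r := up_log 2 _.
set k := fun i => KC U ts (encode [:: (x i : bitseq); u]).
set m := KC U ts u; rewrite -[\sum_(i < l) _]/(\sum_i k i).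
pose b i := KC U (x i) u.
have tP : t \in rects P by apply: transcript_rects.
(* The shift by 2 makes the logarithm positive, so that it absorbs constants. *)
have T1 : 1 <= T by apply: (@leq_trans (trunc_log 2 2)); rewrite // leq_trunc_log // leq_addl.
have hts : size ts <= n by apply: leq_maxr.
have hx i : size (x i) <= n.
  by apply: leq_trans (leq_maxl _ _); apply: (leq_bigmax (F := fun i => size (x i))).
have hm : m <= n + c0 by apply: leq_trans (hc0 _ _) _; rewrite leq_add2r.
have hk i : k i <= n + c0 by apply: leq_trans (hc0 _ _) _; rewrite leq_add2r.
have hb i : b i <= n + c0 by apply: leq_trans (hc0 _ _) _; rewrite leq_add2r.
have hsk : \sum_i k i <= l * (n + c0).
  by rewrite -[l in l * _]card_ord -sum_nat_const; apply: leq_sum => i _; apply: hk.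
(* If the thickness term alone exceeds the sum, the claim is immediate. Otherwise [r] is at most l(n
   + c0), and as a parameter it costs only O(log n) bits. *)
have [le|lt] := leqP (\sum_i k i) r.-1.
  by apply: leq_trans le _; rewrite addnAC leq_addl.
pose q := nth [::] (rect_cells u) (index t (rects P)).
have hq (i : 'I_l) : has (fun cl => nth [::] cl i == x i :> bitseq) q.
  rewrite /q nth_rect_cells //; apply/hasP; exists (cell_list x).
    by apply: map_f; rewrite mem_enum transcript_mem.
  by rewrite nth_cell_list.
have exa (i : 'I_l) : exists a, (exists s, 2 ^ a <= size (fiber U s (b i) u i q)) /\
    forall s, size (fiber U s (b i) u i q) < 2 ^ a.+1.
  have [s hs] := low_KC Uuniv (leqnn (b i)).
  apply: (bounded_log (g := fun s => size (fiber U s (b i) u i q)) (s0 := s)).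
    have : (x i : bitseq) \in fiber U s (b i) u i q by rewrite mem_filter hq.
    by case: (fiber _ _ _ _ _ _).
  by move=> s'; apply: size_fiber.
have [a ha] := choice exa.
have hab i : a i <= (b i).+1.
  have [[s hs] _] := ha i.
  by have := leq_trans hs (size_fiber _ _ _ _ _ _); rewrite leq_exp2l.
(* A common bound for all parameters, with logarithm at most a constant times [T]. *)
pose B := (n + 2) * 2 ^ D.
have hB : (l + 2) * (n + c0 + 2) <= B.
  apply: leq_trans (_ : (n + 2) * D <= B); first by rewrite /D; nia.
  by rewrite leq_mul2l ltnW ?orbT // ltn_expl.
have hT : (trunc_log 2 B).+1 <= (D + 2) * T.
  have n2 : 0 < n + 2 by rewrite addn2.
  have h : trunc_log 2 B <= T + D := trunc_log2_mul D n2.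
  by rewrite mulnDl; have := leq_pmulr D T1; lia.
have sym i : k i + b i <= m + a i + (c1 * (5 * (D + 2)) + c1) * T.
  have jlt : index t (rects P) < size (rect_cells u).
    by rewrite rect_cells_protocol size_map index_mem.
  have := hc1 u (x i) _ m (b i) (a i) i jlt (leqnn _) (leqnn _) (hq i)
    (fun s => ltnW ((ha i).2 s)).
  have : param_cost [:: m; a i; i : nat; b i; m.+1] <= 5 * (trunc_log 2 B).+1.
    apply: param_cost_le => z; have := ltn_ord i; have := hab i; have := hb i.
    by rewrite !inE => ? ? ? /or4P[/eqP->|/eqP->|/eqP->|/orP[]/eqP->]; nia.
  rewrite -/(k i) -/(b i); move: (param_cost _) => Z hZ; nia.
have rect : m + \sum_i a i <= \sum_i b i + l + r + (c2 * ((2 * l + 1) * (D + 2)) + c2) * T.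
  have thick : thickness P t <= 2 ^ r by apply: up_logP.
  have := hc2 ns P t b a r tP thick (fun i => (ha i).1).
  rewrite -/ts -/u -/m.
  have -> : \sum_i (b i).+1 = \sum_i b i + l.
    under eq_bigr do rewrite -addn1.
    by rewrite big_split /= sum1_card card_ord.
  set zs := r :: _.
  have : param_cost zs <= size zs * (trunc_log 2 B).+1.
    apply: param_cost_le => z; rewrite inE mem_cat => /or3P[/eqP->|/mapP[i _ ->]|/mapP[i _ ->]].
    - by nia.
    - by have := hb i; nia.
    - by have := hab i; have := hb i; nia.
  have -> : size zs = 2 * l + 1.
    by rewrite [size zs]/= size_cat 2!size_map size_enum_ord; lia.
  move: (param_cost zs) => Z hZ; nia.
have : \sum_i k i + \sum_i b i <= l * m + \sum_i a i + l * (c1 * (5 * (D + 2)) + c1) * T.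
  have : \sum_i (k i + b i) <= \sum_i (m + a i + (c1 * (5 * (D + 2)) + c1) * T).
    by apply: leq_sum => i _; exact: sym.
  by rewrite !big_split !sum_nat_const card_ord !mulnA.
move: (\sum_i k i) (\sum_i b i) (\sum_i a i) rect => Sk Sb Sa rect hsum.
(* The thickness bound cancels one of the [l] copies of [m], along with the sums of the b_i and
   A_i. *)
have e : l * m = l.-1 * m + m by rewrite -{1}(prednK (ltnW l2)) mulSn addnC.
have : r <= r.-1 + 1 by lia.
have lT := leq_pmulr l T1.
by clear -rect hsum T1 lT e; clearbody D T r m; rewrite !mulnDl in rect *; lia.
Qed.

Import Order.TTheory GRing.Theory Num.Theory.
Local Open Scope ring_scope.

Lemma log2_ge (R : realType) (k v : nat) : (2 ^ k <= v)%N -> k%:R <= log2 (v%:R : R).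
Proof.
move=> h; have ln2 : 0 < ln (2 : R) by rewrite ln_gt0 // ltr1n.
have v0 : (0 < v)%N by apply: leq_trans h; rewrite expn_gt0.
rewrite /log2 ler_pdivlMr // mulr_natl -lnXn ?ltr0n // ler_ln ?posrE ?exprn_gt0 ?ltr0n //.
by rewrite -natrX ler_nat.
Qed.

Theorem theorem7p1 (R : realType) (l : nat) (U : TM) :
  (2 <= l)%N -> universal U ->
  exists c : R,
  forall (ns : 'I_l -> nat) (P : protocol ns) (x : cell ns),
    let t := transcript P x in
    let ts := rect_string P t in
    let n := max_length P x in
    (KC U ts (protocol_string P))%:R >=
      1 / (l%:R - 1) *
        (\sum_(i < l) (KC U ts (encode [:: (x i : bitseq); protocol_string P]))%:R)
      - 1 / (l%:R - 1) * log2 (thickness P t)%:R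
      - c * log2 (n + 2)%:R.
Proof.
move=> l2 Uuniv; have [C hC] := KC_sum_le l2 Uuniv.
exists C%:R => ns P x; cbv zeta; have := hC ns P x; cbv zeta.
set t := transcript P x; set ts := rect_string P t; set n := max_length P x.
pose k (i : 'I_l) := KC U ts (encode [:: (x i : bitseq); protocol_string P]).
set m := KC U ts (protocol_string P) => hsum.
rewrite -natr_sum -[(\sum_(i < l) _)%N]/(\sum_i k i)%N; have thick0 : (0 < thickness P t)%N.
  apply: leq_trans (leq_bigmax_cond (F := cell_thickness P) x _); last exact: transcript_mem.
  rewrite /cell_thickness card_gt0; apply/set0Pn; exists t.
  by rewrite inE transcript_rects transcript_mem.
(* For thickness at least 2 the power of two just below the rounded-up one is smaller than the
   thickness; for thickness 1 both sides vanish. *)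
have hr : (up_log 2 (thickness P t)).-1%:R <= log2 ((thickness P t)%:R : R).
  apply: log2_ge; case: (ltngtP 1 (thickness P t)) thick0 => [h _|[]//|<- _].
    by have /andP[/ltnW] := up_log_bounds (isT : 1 < 2)%N h.
  by rewrite up_log1.
have hn : (trunc_log 2 (n + 2))%:R <= log2 ((n + 2)%:R : R).
  by apply: log2_ge; apply: trunc_logP; rewrite // addn2.
rewrite -(ler_nat R) !natrD !natrM -subn1 natrB ?(ltnW l2) // in hsum.
set lR := l%:R - 1 in hsum *.
have lR1 : 1 <= lR by rewrite /lR lerBrDr -[1 + 1]/(2%:R) ler_nat.
have C0 : 0 <= C%:R :> R by [].
set lg := log2 _ in hr *; set ln := log2 _ in hn *.
have ln0 : 0 <= ln by apply: le_trans hn; rewrite ler0n.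
(* As l - 1 >= 1, the error term may be multiplied by l - 1, and the same constant survives the
   division. *)
have key : (\sum_(i < l) k i)%:R - lg <= lR * (m%:R + C%:R * ln).
  have : C%:R * (trunc_log 2 (n + 2))%:R <= C%:R * ln by rewrite ler_wpM2l.
  have : C%:R * ln <= lR * (C%:R * ln) by rewrite ler_peMl // mulr_ge0.
  by rewrite mulrDr; move: hsum hr; lra.
rewrite lerBlDr -mulrBr div1r mulrC ler_pdivrMr ?(lt_le_trans ltr01) //.
by rewrite [leRHS]mulrC.
Qed.
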